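(* Let $X$ be an infinite countable set with a symmetric, irreflexive adjacency relation $\sim$ such that the resulting graph is connected and every vertex has at most $D<\infty$ neighbors. Let $q:X\to\mathbb{R}$ be such that the restriction $H$ of the Schrödinger operator $\Delta+q$ to $\ell^2(X)$ is a positive self-adjoint operator. Let $\lambda\in\mathbb{R}$ lie strictly below the essential spectrum of $H$, i.e. $\lambda<\inf\sigma_{\mathrm{ess}}(H)$ (with $\inf\emptyset=+\infty$), and let $u:X\to\mathbb{R}$ be a generalized eigenfunction of $H$ to $\lambda$, i.e. $(\Delta+q)u=\lambda u$ pointwise on $X$, satisfying $$\big\|u|_{B_{n+1}\setminus B_{n-1}}\big\|\to 0\qquad\text{as } n\to\infty .$$ Then $u$ decreases exponentially, i.e. there is $r>0$ such that $u\,e^{r|\cdot|}\in\ell^2(X)$.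
   Context: The combinatorial Laplacian acts on functions $f:X\to\mathbb{R}$ by $\Delta f(x)=\sum_{y\sim x}(f(x)-f(y))$. $\ell^2(X)$ is the real Hilbert space of square-summable functions on $X$ (counting measure) with norm $\|\cdot\|$. Since $\Delta$ is bounded on $\ell^2(X)$, $H$ is the operator $f\mapsto \Delta f+qf$ with domain $\{f\in\ell^2(X): qf\in\ell^2(X)\}$. $|x|$ denotes the combinatorial graph distance of $x$ to a fixed vertex $o\in X$, and $B_n=\{x\in X: |x|\le n\}$. $u|_{A}$ denotes the restriction of $u$ to $A$ (extended by zero). *)

(* Defs.v *)
From mathcomp Require Export all_boot all_order all_algebra.
From mathcomp Require Export all_classical all_reals all_analysis.
Export numFieldNormedType.Exports.

Set Implicit Arguments.
Unset Strict Implicit.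
Unset Printing Implicit Defensive.

Import Order.TTheory GRing.Theory Num.Theory.
Local Open Scope classical_set_scope.
Local Open Scope card_scope.
Local Open Scope ring_scope.

Section Graph.
Context (X : choiceType).
Implicit Types (adj : rel X) (o x y : X).

Definition nbrs adj x : set X := [set y | adj x y].

Definition bounded_degree adj (D : nat) : Prop :=
  forall x, nbrs adj x #<= `I_D.

Definition walk adj x y (n : nat) : Prop :=
  exists p : seq X, [/\ path adj x p, last x p = y & size p = n].

Definition connected_graph adj : Prop := forall x y, exists n, walk adj x y n.

(* The least length of a walk from [o] to [x]; the default [0] is reached only
   when there is no walk, hence never in a connected graph. *)
Definition gdist adj o x : nat :=
  xget 0%N [set n | walk adj o x n /\ forall m, walk adj o x m -> (n <= m)%N].

(* The radius is an integer so that the ball of radius [-1] is empty. *)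
Definition gball adj o (n : int) : set X :=
  [set x | (gdist adj o x)%:Z <= n].

End Graph.

Section L2.
Context (R : realType) (X : choiceType).
Implicit Types f g : X -> R.

Definition l2 : set (X -> R) :=
  [set f | (\esum_(x in [set: X]) (f x ^+ 2)%:E < +oo)%E].

(* Meaningful for [f] in [l2]. *)
Definition l2norm f : R :=
  Num.sqrt (fine (\esum_(x in [set: X]) (f x ^+ 2)%:E)).

(* [esum] only sums nonnegative families, so the absolutely convergent sum of
   [f x * g x] (for [f] and [g] in [l2]) is split into its positive and
   negative parts. *)
Definition l2dot f g : R :=
  fine (\esum_(x in [set: X]) (Num.max (f x * g x) 0)%:E) -
  fine (\esum_(x in [set: X]) (Num.max (- (f x * g x)) 0)%:E).

Definition zero_extend (A : set X) f : X -> R := patch (fun=> 0) A f.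

End L2.

Arguments l2 {R X}.

(* A possibly unbounded operator in l^2(X); [app] is only meaningful on [dom]. *)
Record operator (R : realType) (X : choiceType) := Operator {
  dom : set (X -> R);
  app :> (X -> R) -> X -> R }.

Section Spectrum.
Context (R : realType) (X : choiceType).
Implicit Types T : operator R X.

Definition densely_defined T : Prop :=
  dom T `<=` l2 /\
  forall g : X -> R, l2 g -> forall e : R, 0 < e ->
    exists2 f, dom T f & l2norm (g \- f) < e.

Definition graph_of T : set ((X -> R) * (X -> R)) :=
  [set fg | dom T fg.1 /\ fg.2 = T fg.1].

Definition adjoint_graph T : set ((X -> R) * (X -> R)) :=
  [set gh | [/\ l2 gh.1, l2 gh.2 &
    forall f, dom T f -> l2dot (T f) gh.1 = l2dot f gh.2]].

Definition self_adjoint T : Prop :=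
  densely_defined T /\ adjoint_graph T = graph_of T.

Definition positive_operator T : Prop :=
  forall f, dom T f -> 0 <= l2dot (T f) f.

Definition shift T (z : R) (f : X -> R) : X -> R := fun x => T f x - z * f x.

Definition resolvent_set T : set R :=
  [set z | set_bij (dom T) l2 (shift T z) /\
    exists C : R, forall f, dom T f -> l2norm f <= C * l2norm (shift T z f)].

(* The spectrum of a self-adjoint operator is real, so that real spectral
   parameters are enough. *)
Definition spectrum T : set R := ~` resolvent_set T.

Definition eigenspace_of T (z : R) : set (X -> R) :=
  [set f | dom T f /\ forall x, T f x = z * f x].

Definition eigenvalue_of T (z : R) : Prop :=
  exists2 f, eigenspace_of T z f & exists x, f x != 0.

Definition finite_dimensional (V : set (X -> R)) : Prop :=
  exists (n : nat) (e : 'I_n -> X -> R), forall f, V f ->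
    exists c : 'I_n -> R, forall x, f x = \sum_(i < n) c i * e i x.

Definition discrete_spectrum T : set R :=
  [set z | [/\ isolated (spectrum T) z, eigenvalue_of T z &
               finite_dimensional (eigenspace_of T z)]].

Definition essential_spectrum T : set R := spectrum T `\` discrete_spectrum T.

End Spectrum.

Section Schroedinger.
Context (R : realType) (X : choiceType).
Implicit Types (adj : rel X) (q f : X -> R).

Definition laplacian adj f : X -> R :=
  fun x => \sum_(y \in nbrs adj x) (f x - f y).

Definition schroedinger adj q f : X -> R :=
  fun x => laplacian adj f x + q x * f x.

Definition schroedinger_op adj q : operator R X :=
  Operator [set f | l2 f /\ l2 (fun x => q x * f x)] (schroedinger adj q).

End Schroedinger.

(* Main.v *)
(* Let [A = H - lambda]. If no [mu <= lambda] is essential, there are a finite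
   set [K] and [d > 0] such that the form of [A] is at least [d |f|^2] for [f]
   vanishing on [K]. Otherwise the best constant off finite sets has a supremum
   [mu <= lambda] of [H], and there are almost minimizing functions supported
   arbitrarily far away. Either [mu] is regular, or it is isolated and its
   finite-dimensional eigenspace is almost orthogonal to such functions, so that
   [(H - mu - t)^-1] is bounded on them uniformly as [t -> 0]; applying the
   Cauchy-Schwarz inequality to the form of [H - mu] contradicts almost
   minimality.

   For the cut-off [f] of [u] to [n < |x| <= N] the form of [A] only involves the
   edges leaving this region. Letting [N -> oo], where the boundary terms vanish
   by assumption, yields [d * sum_(k > n) b k <= D (b n + b (n + 1))] for the
   masses [b k] of [u^2] on spheres, hence the tails of [b] decay geometrically. *)

Require Import Defs.
From mathcomp Require Import finmap ring lra zify.
Import Order.TTheory GRing.Theory Num.Theory.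
Set Implicit Arguments.
Unset Strict Implicit.
Unset Printing Implicit Defensive.
Local Open Scope classical_set_scope.
Local Open Scope ring_scope.

(** * Square-summable functions *)

Section FiniteSums.
Context (R : realType) (X : choiceType).
Implicit Types (p : X -> R) (A : set X).

(** No spectral theorem is used: functional calculus is replaced by inequalities between inner
    products. Near a point [mu] whose punctured neighbourhood of radius [r] is regular, a polynomial
    inequality valid for a = 0 and for |a| >= r becomes one between norms of f, A f and A (A f),
    with A = T - mu. The spectral projection at [mu] is not constructed either; it only appears, up
    to sign, as the limit of t (A - t)^-1 f as t -> 0. The parameter t stays nonzero because A has a
    kernel when [mu] is an eigenvalue. The factor 1 / t of the resolvent on the eigenspace is
    harmless since the finite set on which f must vanish is chosen after t. A lower bound of the
    form is known only for functions vanishing on a finite set, where (A - t)^-1 f need not vanish.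
    Its values there are inner products of f with fixed functions, hence small for f supported far
    away, and subtracting them costs little. Since u is not known to be square-summable, every sum
    of masses stays finite until the very end. *)

Lemma fsum_subset A B p : finite_set B -> A `<=` B -> (forall x, 0 <= p x) ->
  \sum_(x \in A) p x <= \sum_(x \in B) p x.
Proof.
move=> finB AB p0; rewrite [leRHS](fsbigID A)//= (_ : B `&` A = A).
  by rewrite lerDl fsumr_ge0.
by rewrite setIC; apply/setIidPl.
Qed.

End FiniteSums.

Section NonnegativeSums.
Context (R : realType) (X : choiceType).
Implicit Types (p : X -> R) (A : set X).

Definition psummable p : Prop := (\esum_(x in [set: X]) (p x)%:E < +oo)%E.
Definition psum p : R := fine (\esum_(x in [set: X]) (p x)%:E).

Lemma psumK p : (forall x, 0 <= p x) -> psummable p ->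
  (\esum_(x in [set: X]) (p x)%:E = (psum p)%:E)%E.
Proof.
move=> p0 sp; rewrite /psum fineK// ge0_fin_numE//.
by apply: esum_ge0 => x _; rewrite lee_fin.
Qed.

Lemma psum_ge0 p : (forall x, 0 <= p x) -> 0 <= psum p.
Proof. by move=> p0; apply/fine_ge0/esum_ge0 => x _; rewrite lee_fin. Qed.

Lemma fsum_le_psum p A : (forall x, 0 <= p x) -> psummable p -> finite_set A ->
  \sum_(x \in A) p x <= psum p.
Proof.
move=> p0 sp finA; rewrite -lee_fin -psumK// -fsumEFin//.
by apply: esum_ge; exists A => //; split.
Qed.

Lemma psummable_le p (M : R) : (forall A, finite_set A -> \sum_(x \in A) p x <= M) ->
  psummable p.
Proof.
move=> pM; apply: (@le_lt_trans _ _ M%:E); last exact: ltry.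
by apply: ge_ereal_sup => _ [A [finA _] <-]; rewrite fsumEFin// lee_fin pM.
Qed.

Lemma psum_le p (M : R) : (forall x, 0 <= p x) ->
  (forall A, finite_set A -> \sum_(x \in A) p x <= M) -> psum p <= M.
Proof.
move=> p0 pM; rewrite -lee_fin -psumK//; last exact: psummable_le pM.
by apply: ge_ereal_sup => _ [A [finA _] <-]; rewrite fsumEFin// lee_fin pM.
Qed.

Lemma psum_approx p e : (forall x, 0 <= p x) -> 0 < e ->
  exists2 A, finite_set A & psum p - e < \sum_(x \in A) p x.
Proof.
move=> p0 e0; apply: contrapT => nA.
have /psum_le : forall A, finite_set A -> \sum_(x \in A) p x <= psum p - e.
  by move=> A finA; rewrite leNgt; apply/negP => lt; apply: nA; exists A.
by move=> /(_ p0); lra.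
Qed.

Lemma psummableD p q : (forall x, 0 <= p x) -> (forall x, 0 <= q x) ->
  psummable p -> psummable q -> psummable (p \+ q).
Proof.
move=> p0 q0 sp sq; rewrite /psummable.
under eq_esum do rewrite EFinD.
rewrite esumD//; last 2 first.
- by move=> x _; rewrite lee_fin.
- by move=> x _; rewrite lee_fin.
by rewrite lte_add_pinfty.
Qed.

Lemma psumD p q : (forall x, 0 <= p x) -> (forall x, 0 <= q x) ->
  psummable p -> psummable q -> psum (p \+ q) = psum p + psum q.
Proof.
move=> p0 q0 sp sq; apply: EFin_inj.
rewrite EFinD -!psumK//; last first.
- exact: psummableD.
- by move=> x; rewrite addr_ge0.
under eq_esum do rewrite EFinD.
by rewrite esumD// => x _; rewrite lee_fin.
Qed.

Lemma le_psummable p q : (forall x, p x <= q x) -> psummable q -> psummable p.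
Proof.
move=> pq; apply: le_lt_trans; apply: le_esum => x _.
by rewrite lee_fin.
Qed.

Lemma psummableZ a p : 0 <= a -> (forall x, 0 <= p x) -> psummable p ->
  psummable (fun x => a * p x).
Proof.
move=> a0 p0 sp; apply: (@psummable_le _ (a * psum p)) => A finA.
by rewrite -mulr_fsumr ler_wpM2l// fsum_le_psum.
Qed.

Lemma psumZ a p : 0 <= a -> (forall x, 0 <= p x) -> psummable p ->
  psum (fun x => a * p x) = a * psum p.
Proof.
move=> a0 p0 sp; apply/eqP; rewrite eq_le; apply/andP; split.
  apply: psum_le => [x|A finA]; first by rewrite mulr_ge0.
  by rewrite -mulr_fsumr ler_wpM2l// fsum_le_psum.
have [->|an0] := eqVneq a 0.
  by rewrite mul0r psum_ge0// => x; rewrite mul0r.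
have {an0}a0 : 0 < a by rewrite lt_neqAle eq_sym an0.
rewrite -ler_pdivlMl//; apply: psum_le => // A finA.
rewrite ler_pdivlMl// mulr_fsumr fsum_le_psum//.
- by move=> x; rewrite mulr_ge0// ltW.
- by apply: psummableZ => //; exact: ltW.
Qed.

(** Cross-adding turns the equality of differences into one between sums of nonnegative families,
    where additivity is available. *)
Lemma psumB p q p' q' : (forall x, 0 <= p x) -> (forall x, 0 <= q x) ->
  (forall x, 0 <= p' x) -> (forall x, 0 <= q' x) ->
  psummable p -> psummable q -> psummable p' -> psummable q' ->
  (forall x, p x - q x = p' x - q' x) -> psum p - psum q = psum p' - psum q'.
Proof.
move=> p0 q0 p'0 q'0 sp sq sp' sq' e.
suff : psum (p \+ q') = psum (p' \+ q) by rewrite !psumD//; lra.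
rewrite /psum; congr fine; apply: eq_esum => x _.
by rewrite /= -[p x](subrK (q x)) e; congr EFin; ring.
Qed.

End NonnegativeSums.

Lemma maxr0B (R : realType) (a : R) : Num.max a 0 - Num.max (- a) 0 = a.
Proof. by case: (leP a 0); case: (leP (- a) 0); lra. Qed.

Section InnerProduct.
Context (R : realType) (X : choiceType).
Implicit Types (p f g h : X -> R) (A : set X).

Lemma l2_lin a f g : l2 f -> l2 g -> l2 (a *: f + g).
Proof.
move=> lf lg.
apply: (@le_psummable _ _ _ ((fun x => (2 * a ^+ 2) * f x ^+ 2) \+ (fun x => 2 * g x ^+ 2))).
  move=> x; rewrite !fctE /= /GRing.scale /=.
  have := sqr_ge0 (a * f x - g x); nra.
apply: psummableD.
- by move=> x; have := sqr_ge0 a; have := sqr_ge0 (f x); nra.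
- by move=> x; have := sqr_ge0 (g x); nra.
- apply: psummableZ => // [|x]; last exact: sqr_ge0.
  by have := sqr_ge0 a; nra.
- by apply: psummableZ => // x; exact: sqr_ge0.
Qed.

Lemma l2Z a f : l2 f -> l2 (a *: f).
Proof.
move=> lf; rewrite (_ : a *: f = (a - 1) *: f + f); first exact: l2_lin.
by rewrite scalerBl scale1r subrK.
Qed.

Lemma l2D f g : l2 f -> l2 g -> l2 (f + g).
Proof. by move=> lf lg; rewrite -[f]scale1r; exact: l2_lin. Qed.

Lemma l2N f : l2 f -> l2 (- f).
Proof. by move=> lf; rewrite -scaleN1r; exact: l2Z. Qed.

Lemma l2B f g : l2 f -> l2 g -> l2 (f - g).
Proof. by move=> lf lg; apply: l2D => //; exact: l2N. Qed.

Lemma l2_0 : l2 (0 : X -> R).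
Proof.
apply: (@psummable_le _ _ _ 0) => A _.
by rewrite fsbig1// => x _; exact: expr0n.
Qed.

Lemma l2_sum (I : Type) (r : seq I) (P : pred I) (F : I -> X -> R) :
  (forall i, l2 (F i)) -> l2 (\sum_(i <- r | P i) F i).
Proof.
by move=> lF; apply: (big_ind (fun f => l2 f)) => //; [exact: l2_0|exact: l2D].
Qed.

Lemma l2_max_psummable f g : l2 f -> l2 g ->
  psummable (fun x => Num.max (f x * g x) 0).
Proof.
move=> lf lg; apply: (@le_psummable _ _ _ ((fun x => f x ^+ 2) \+ (fun x => g x ^+ 2))).
  move=> x /=; rewrite ge_max addr_ge0 ?sqr_ge0// andbT.
  by have := sqr_ge0 (f x - g x); have := sqr_ge0 (f x + g x); nra.
by apply: psummableD => // x; rewrite sqr_ge0.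
Qed.

Lemma l2_maxN_psummable f g : l2 f -> l2 g ->
  psummable (fun x => Num.max (- (f x * g x)) 0).
Proof.
move=> lf lg; have := l2_max_psummable (l2N lf) lg.
by apply: le_psummable => x; rewrite fctE mulNr.
Qed.

(* Any splitting of [f * g] into nonnegative summable parts computes [l2dot]. *)
Lemma l2dotE f g p q : l2 f -> l2 g ->
  (forall x, 0 <= p x) -> (forall x, 0 <= q x) -> psummable p -> psummable q ->
  (forall x, f x * g x = p x - q x) -> l2dot f g = psum p - psum q.
Proof.
move=> lf lg p0 q0 sp sq e; apply: psumB => //.
- by move=> x; rewrite le_max lexx orbT.
- by move=> x; rewrite le_max lexx orbT.
- exact: l2_max_psummable.
- exact: l2_maxN_psummable.
by move=> x; rewrite -e maxr0B.
Qed.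

Lemma l2dotC f g : l2dot f g = l2dot g f.
Proof. by rewrite /l2dot; congr (fine _ - fine _); apply: eq_esum => x _; rewrite mulrC. Qed.

Lemma l2dotDl f g h : l2 f -> l2 g -> l2 h ->
  l2dot (f + g) h = l2dot f h + l2dot g h.
Proof.
move=> lf lg lh.
pose P (f : X -> R) x := Num.max (f x * h x) 0.
pose Q (f : X -> R) x := Num.max (- (f x * h x)) 0.
have P0 k x : 0 <= P k x by rewrite le_max lexx orbT.
have Q0 k x : 0 <= Q k x by rewrite le_max lexx orbT.
have PQ k x : k x * h x = P k x - Q k x.
  by rewrite maxr0B.
have sP k : l2 k -> psummable (P k) by move=> lk; exact: l2_max_psummable.
have sQ k : l2 k -> psummable (Q k) by move=> lk; exact: l2_maxN_psummable.
rewrite (@l2dotE _ _ (P f \+ P g) (Q f \+ Q g))//.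
- rewrite (psumD (P0 f) (P0 g) (sP f lf) (sP g lg)).
  rewrite (psumD (Q0 f) (Q0 g) (sQ f lf) (sQ g lg)).
  rewrite (l2dotE lf lh (P0 f) (Q0 f) (sP f lf) (sQ f lf) (PQ f)).
  rewrite (l2dotE lg lh (P0 g) (Q0 g) (sP g lg) (sQ g lg) (PQ g)).
  ring.
- exact: l2D.
- by move=> x; rewrite addr_ge0.
- by move=> x; rewrite addr_ge0.
- exact (psummableD (P0 f) (P0 g) (sP f lf) (sP g lg)).
- exact (psummableD (Q0 f) (Q0 g) (sQ f lf) (sQ g lg)).
by move=> x; rewrite fctE mulrDl !PQ/=; ring.
Qed.

Lemma l2dotNl f g : l2dot (- f) g = - l2dot f g.
Proof.
rewrite /l2dot opprB; congr (fine _ - fine _); apply: eq_esum => x _.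
  by rewrite fctE mulNr.
by rewrite fctE mulNr opprK.
Qed.

Lemma l2dotZl a f g : l2 f -> l2 g -> l2dot (a *: f) g = a * l2dot f g.
Proof.
move=> lf lg.
wlog a0 : a / 0 <= a.
  move=> H; case: (leP 0 a) => [|/ltW a0]; first exact: H.
  by rewrite -[a]opprK scaleNr l2dotNl mulNr H// oppr_ge0.
pose P x := Num.max (f x * g x) 0.
pose Q x := Num.max (- (f x * g x)) 0.
have P0 x : 0 <= P x by rewrite le_max lexx orbT.
have Q0 x : 0 <= Q x by rewrite le_max lexx orbT.
have sP : psummable P by exact: l2_max_psummable.
have sQ : psummable Q by exact: l2_maxN_psummable.
rewrite (@l2dotE _ _ (fun x => a * P x) (fun x => a * Q x))//.
- by rewrite !psumZ// -mulrBr.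
- exact: l2Z.
- by move=> x; rewrite mulr_ge0.
- by move=> x; rewrite mulr_ge0.
- exact: psummableZ.
- exact: psummableZ.
by move=> x; rewrite -mulrBr fctE /GRing.scale /= -mulrA maxr0B.
Qed.

Lemma l2dotDr f g h : l2 f -> l2 g -> l2 h ->
  l2dot h (f + g) = l2dot h f + l2dot h g.
Proof. by move=> lf lg lh; rewrite l2dotC l2dotDl// ![l2dot _ h]l2dotC. Qed.

Lemma l2dotZr a f g : l2 f -> l2 g -> l2dot f (a *: g) = a * l2dot f g.
Proof. by move=> lf lg; rewrite l2dotC l2dotZl// l2dotC. Qed.

Lemma l2dotNr f g : l2dot f (- g) = - l2dot f g.
Proof. by rewrite l2dotC l2dotNl l2dotC. Qed.

Lemma l2dot0l f : l2dot 0 f = 0.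
Proof.
have z x : (0 : X -> R) x = 0 by [].
by rewrite /l2dot !esum1 ?subrr// => x _; rewrite z mul0r ?oppr0 maxxx.
Qed.

Lemma l2dot_suml (I : Type) (r : seq I) (P : pred I) (F : I -> X -> R) g :
  (forall i, l2 (F i)) -> l2 g ->
  l2dot (\sum_(i <- r | P i) F i) g = \sum_(i <- r | P i) l2dot (F i) g.
Proof.
move=> lF lg.
suff [] : l2 (\sum_(i <- r | P i) F i) /\
  l2dot (\sum_(i <- r | P i) F i) g = \sum_(i <- r | P i) l2dot (F i) g by [].
apply: (big_ind2 (fun f a => l2 f /\ l2dot f g = a)) => //.
- by split; [exact: l2_0|rewrite l2dot0l].
- by move=> f a h b [lf <-] [lh <-]; split; [exact: l2D|rewrite l2dotDl].
Qed.

Definition l2sq f : R := l2dot f f.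

Lemma l2sqE f : l2sq f = psum (fun x => f x ^+ 2).
Proof.
rewrite /l2sq /l2dot [X in _ - X](_ : _ = 0) ?subr0; last first.
  by rewrite esum1// => x _; rewrite (max_idPr _)// oppr_le0 -expr2 sqr_ge0.
rewrite /psum; congr fine; apply: eq_esum => x _.
by rewrite (max_idPl _)// -expr2 sqr_ge0.
Qed.

Lemma l2sq_ge0 f : 0 <= l2sq f.
Proof. by rewrite l2sqE psum_ge0// => x; rewrite sqr_ge0. Qed.

Lemma l2normE f : l2norm f = Num.sqrt (l2sq f).
Proof. by rewrite l2sqE. Qed.

Lemma fsum_le_l2sq f A : l2 f -> finite_set A ->
  \sum_(x \in A) f x ^+ 2 <= l2sq f.
Proof. by move=> lf finA; rewrite l2sqE fsum_le_psum// => x; rewrite sqr_ge0. Qed.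

Lemma le_l2sq f x : l2 f -> f x ^+ 2 <= l2sq f.
Proof.
by move=> lf; have := fsum_le_l2sq lf (finite_set1 x); rewrite fsbig_set1.
Qed.

Lemma l2sq_eq0 f : l2 f -> l2sq f = 0 -> f = 0.
Proof.
move=> lf f0; apply/funext => x; apply/eqP.
by have := le_l2sq x lf; rewrite f0 real_exprn_even_le0 ?num_real.
Qed.

Lemma l2sqDE f g : l2 f -> l2 g ->
  l2sq (f + g) = l2sq f + 2 * l2dot f g + l2sq g.
Proof.
move=> lf lg; have lfg := l2D lf lg.
by rewrite /l2sq l2dotDl// !l2dotDr// [l2dot g f]l2dotC; ring.
Qed.

Lemma l2sqZ a f : l2 f -> l2sq (a *: f) = a ^+ 2 * l2sq f.
Proof. by move=> lf; rewrite /l2sq l2dotZl ?l2dotZr//; [ring|exact: l2Z]. Qed.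

Lemma l2sqN f : l2sq (- f) = l2sq f.
Proof. by rewrite /l2sq l2dotNl l2dotNr opprK. Qed.

Lemma l2sqBE f g : l2 f -> l2 g ->
  l2sq (f - g) = l2sq f - 2 * l2dot f g + l2sq g.
Proof. by move=> lf lg; rewrite l2sqDE ?l2dotNr ?l2sqN; [ring|..|exact: l2N]. Qed.

Lemma l2sqD_le f g : l2 f -> l2 g -> l2sq (f + g) <= 2 * l2sq f + 2 * l2sq g.
Proof.
move=> lf lg; have := l2sq_ge0 (f - g).
by rewrite l2sqBE// l2sqDE//; lra.
Qed.

Lemma l2dot_CS f g : l2 f -> l2 g -> l2dot f g ^+ 2 <= l2sq f * l2sq g.
Proof.
move=> lf lg.
have [g0|g0] := eqVneq (l2sq g) 0.
  by rewrite (l2sq_eq0 lg g0) l2dotC l2dot0l /l2sq l2dot0l mulr0 expr0n.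
have {}g0 : 0 < l2sq g by rewrite lt_neqAle eq_sym g0 l2sq_ge0.
have := l2sq_ge0 (l2sq g *: f - l2dot f g *: g).
rewrite (l2sqBE (l2Z _ lf) (l2Z _ lg)) !l2sqZ// l2dotZl ?l2dotZr//; last exact: l2Z.
have -> : l2sq g ^+ 2 * l2sq f - 2 * (l2sq g * (l2dot f g * l2dot f g)) +
  l2dot f g ^+ 2 * l2sq g = l2sq g * (l2sq f * l2sq g - l2dot f g ^+ 2) by ring.
by rewrite pmulr_rge0// subr_ge0.
Qed.

(** Expansion of |f - c g|^2 >= 0. With c fixed this serves linear arithmetic in place of
    Cauchy-Schwarz. *)
Lemma l2dot_AMGM f g c : l2 f -> l2 g ->
  2 * (c * l2dot f g) <= l2sq f + c ^+ 2 * l2sq g.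
Proof.
move=> lf lg; have := l2sq_ge0 (f - c *: g).
by rewrite l2sqBE ?l2dotZr// ?l2sqZ//; [lra|exact: l2Z].
Qed.

Lemma fsumrD_sqr_le (p r : X -> R) A : finite_set A ->
  \sum_(x \in A) (p x + r x) ^+ 2 <=
  2 * (\sum_(x \in A) p x ^+ 2) + 2 * (\sum_(x \in A) r x ^+ 2).
Proof.
move=> finA; rewrite !mulr_fsumr -fsbig_split//=.
rewrite !fsbig_finite//; apply: ler_sum => x _.
by have := sqr_ge0 (p x - r x); nra.
Qed.

(* The limit is taken pointwise, as a supremum; the norms pass to the limit
   because they are suprema of finite sums. *)
Lemma l2_complete (F : nat -> X -> R) (c : nat -> R) :
  (forall n, l2 (F n)) ->
  (forall e n, 0 < e -> exists2 m, (n <= m)%N & c m <= e) ->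
  (forall n m, (n <= m)%N -> l2sq (F m - F n) <= c n) ->
  exists2 f, l2 f & forall n, l2sq (f - F n) <= 2 * c n.
Proof.
move=> lF c_small cF.
have c0 n : 0 <= c n by apply: le_trans (l2sq_ge0 _) (cF n n _).
have ptF n m x : (n <= m)%N -> `|F m x - F n x| <= Num.sqrt (c n).
  move=> nm; rewrite -sqrtr_sqr ler_sqrt ?c0//.
  by apply: le_trans (cF _ _ nm); apply: (le_l2sq x (l2B (lF m) (lF n))).
have FF n m x : F m x - Num.sqrt (c m) <= F n x + Num.sqrt (c n).
  have s0 k : 0 <= Num.sqrt (c k) by exact: sqrtr_ge0.
  have [/(ptF _ _ x)|/ltnW/(ptF _ _ x)] := leqP n m; rewrite ler_norml;
    by have := s0 n; have := s0 m; lra.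
(* By [FF] every lower end [F m x - sqrt (c m)] is below every upper end [F n x + sqrt (c n)], so
   their supremum lies in all the intervals at once. *)
pose f x := sup [set F m x - Num.sqrt (c m) | m in [set: nat]].
have fF n x : `|f x - F n x| <= Num.sqrt (c n).
  rewrite ler_distl; apply/andP; split.
    apply: ub_le_sup; last by exists n.
    by exists (F 0 x + Num.sqrt (c 0)) => _ [m _ <-]; exact: FF.
  apply: ge_sup; first by exists (F 0 x - Num.sqrt (c 0)); exists 0.
  by move=> _ [m _ <-]; exact: FF.
have fF2 n x : (f x - F n x) ^+ 2 <= c n.
  by rewrite -real_normK ?num_real// -[leRHS]sqr_sqrtr// lerXn2r// nnegrE// sqrtr_ge0.
have sumle n A : finite_set A -> \sum_(x \in A) (f x - F n x) ^+ 2 <= 2 * c n.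
  move=> finA; apply/ler_addgt0Pl => e e0.
  pose k : R := (size (enum_fset (fset_set A)))%:R.
  have k0 : 0 <= k by exact: ler0n.
  (* Pointwise closeness costs [k * c m] on the [k] points of [A]; the comparison index [m] is taken
     so late that twice this is below [e]. *)
  have [m nm cm] := c_small (e / (2 * k + 1)) n ltac:(by rewrite divr_gt0//; lra).
  have -> : \sum_(x \in A) (f x - F n x) ^+ 2 =
    \sum_(x \in A) ((f x - F m x) + (F m x - F n x)) ^+ 2.
    by apply: eq_fsbigr => x _; congr (_ ^+ 2); ring.
  apply: le_trans (fsumrD_sqr_le _ _ finA) _.
  apply: lerD.
    have le1 : \sum_(x \in A) (f x - F m x) ^+ 2 <= k * c m.
      rewrite fsbig_finite// mulr_natl /k.
      apply: le_trans (ler_sum _ (fun x _ => fF2 m x)) _.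
      by rewrite big_const_seq count_predT iter_addr_0.
    have := @ler_wpM2l R (2 * k + 1) ltac:(lra) _ _ cm.
    rewrite mulrCA divff ?mulr1; last by apply: lt0r_neq0; lra.
    by have := c0 m; nra.
  rewrite ler_pM2l//; apply: le_trans (cF _ _ nm).
  exact: (fsum_le_l2sq (l2B (lF m) (lF n)) finA).
have lf : l2 f.
  rewrite -[f](subrK (F 0)); apply: l2D => //.
  by apply: (@psummable_le _ _ _ (2 * c 0)) => A; exact: sumle.
exists f => // n; rewrite l2sqE; apply: psum_le => [x|A]; first exact: sqr_ge0.
exact: sumle.
Qed.

Lemma zero_extend_in A f x : A x -> zero_extend A f x = f x.
Proof. by move=> Ax; rewrite /zero_extend /patch mem_set. Qed.

Lemma zero_extend_out A f x : ~ A x -> zero_extend A f x = 0.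
Proof. by move=> Ax; rewrite /zero_extend /patch memNset. Qed.

Lemma l2_zero_extend A f : l2 f -> l2 (zero_extend A f).
Proof.
apply: le_psummable => x.
have [Ax|Ax] := pselect (A x); first by rewrite zero_extend_in.
by rewrite zero_extend_out// expr0n/= sqr_ge0.
Qed.

Lemma psum_fin p A : (forall x, 0 <= p x) -> finite_set A ->
  (forall x, ~ A x -> p x = 0) -> psum p = \sum_(x \in A) p x.
Proof.
move=> p0 finA pA.
have le B : finite_set B -> \sum_(x \in B) p x <= \sum_(x \in A) p x.
  move=> finB; rewrite (_ : \sum_(x \in A) p x = \sum_(x \in A `|` B) p x).
    by apply: fsum_subset => //; rewrite finite_setU.
  by apply: fsbig_widen => // x [_ /pA].
apply/eqP; rewrite eq_le psum_le//=.
by apply: fsum_le_psum => //; exact: psummable_le le.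
Qed.

Lemma fin_l2 f A : finite_set A -> (forall x, ~ A x -> f x = 0) -> l2 f.
Proof.
move=> finA fA; apply: (@psummable_le _ _ _ (\sum_(x \in A) f x ^+ 2)) => B finB.
rewrite (_ : \sum_(x \in A) f x ^+ 2 = \sum_(x \in A `|` B) f x ^+ 2).
  by apply: fsum_subset; rewrite ?finite_setU// => x; exact: sqr_ge0.
by apply: fsbig_widen => // x [_ /fA /= ->]; rewrite expr0n.
Qed.

Lemma l2dot_fin f g A : finite_set A -> (forall x, ~ A x -> f x = 0) ->
  l2dot f g = \sum_(x \in A) f x * g x.
Proof.
move=> finA fA; rewrite /l2dot -!/(psum _).
rewrite !(@psum_fin _ A)//; last 4 first.
- by move=> x; rewrite le_max lexx orbT.
- by move=> x /fA ->; rewrite mul0r oppr0 maxxx.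
- by move=> x; rewrite le_max lexx orbT.
- by move=> x /fA ->; rewrite mul0r maxxx.
by rewrite !fsbig_finite// -sumrB; apply: eq_bigr => x _; rewrite maxr0B.
Qed.

Definition dirac1 x : X -> R := zero_extend [set x] (fun=> 1).

Lemma dirac1E x y : dirac1 x y = (x == y)%:R.
Proof.
rewrite /dirac1; case: (eqVneq x y) => [->|xy]; first by rewrite zero_extend_in.
by rewrite zero_extend_out// => /esym; exact/eqP.
Qed.

Lemma l2_dirac1 x : l2 (dirac1 x).
Proof.
apply: (fin_l2 (finite_set1 x)) => y; rewrite dirac1E /=.
by case: eqP => // ->.
Qed.

Lemma l2dot_dirac1 x f : l2dot (dirac1 x) f = f x.
Proof.
rewrite (l2dot_fin f (finite_set1 x)).
  by rewrite fsbig_set1 dirac1E eqxx mul1r.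
by move=> y; rewrite dirac1E /=; case: eqP => // ->.
Qed.

Lemma zero_extend_sum A f : finite_set A ->
  zero_extend A f = \sum_(x <- fset_set A) f x *: dirac1 x.
Proof.
move=> finA; apply/funext => y; rewrite fct_sumE -fsbig_finite//.
have E x : (f x *: dirac1 x) y = f x * (x == y)%:R by rewrite -dirac1E.
under eq_fsbigr do rewrite E.
have [Ay|Ay] := pselect (A y); last first.
  rewrite zero_extend_out// fsbig1// => x Ax.
  by case: eqP Ax => [->|]; rewrite ?mulr0.
rewrite zero_extend_in// (fsbigD1 y)//= eqxx mulr1 fsbig1 ?addr0//.
by move=> x [_ /= /eqP/negPf ->]; rewrite mulr0.
Qed.

(** If [A] carries all of |f|^2 up to [e], a function vanishing on [A] only sees the tail of [f],
    and Cauchy-Schwarz applies. This is a quantitative form of the weak convergence to 0 of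
    normalized functions whose supports move to infinity. *)
Lemma l2_tail f e : l2 f -> 0 < e -> exists2 A, finite_set A &
  forall g, l2 g -> (forall x, A x -> g x = 0) -> l2dot f g ^+ 2 <= e * l2sq g.
Proof.
move=> lf e0.
have [|A finA fA] := psum_approx _ e0 (p := fun x => f x ^+ 2).
  by move=> x; exact: sqr_ge0.
exists A => // g lg g0.
have lfA : l2 (zero_extend (~` A) f) by exact: l2_zero_extend.
have -> : l2dot f g = l2dot (zero_extend (~` A) f) g.
  rewrite /l2dot; congr (fine _ - fine _); apply: eq_esum => x _;
  by have [Ax|Ax] := pselect (A x); [rewrite g0// !mulr0|rewrite zero_extend_in].
apply: le_trans (l2dot_CS lfA lg) _; rewrite ler_wpM2r ?l2sq_ge0//.
rewrite l2sqE; apply: psum_le => [x|B finB]; first exact: sqr_ge0.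
have fAB := fsum_le_l2sq lf (_ : finite_set (A `|` B)).
have {fAB} := fAB ltac:(by rewrite finite_setU).
rewrite (fsbigID A) ?finite_setU// setUK.
rewrite (_ : \sum_(x \in B) _ = \sum_(x \in (A `|` B) `&` ~` A) f x ^+ 2); last first.
  rewrite (fsbigID A)//= fsbig1 ?add0r; last first.
    by move=> x [_ Ax]; rewrite zero_extend_out ?expr0n// => nA; exact: nA.
  rewrite setIUl setICr set0U; apply: eq_fsbigr => x /set_mem [_ nAx].
  by rewrite zero_extend_in.
by rewrite -l2sqE in fA *; move: fA; rewrite /=; lra.
Qed.

End InnerProduct.

(** * Self-adjoint operators *)

Section SelfAdjointOperator.
Context (R : realType) (X : choiceType) (T : operator R X).
Implicit Types (f g h : X -> R) (a c z mu : R).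

(** The record [operator] carries no linearity; closure of the domain under combinations is part of
    the notion. *)
Definition linear_operator : Prop := forall a f g, dom T f -> dom T g ->
  dom T (a *: f + g) /\ T (a *: f + g) = a *: T f + T g.

Context (Tlin : linear_operator) (Tsa : self_adjoint T).

Lemma dom_l2 f : dom T f -> l2 f.
Proof. by case: Tsa => -[dl _] _ /dl. Qed.

(** Read from left to right, this is how a function is shown to lie in the domain: testing against
    the domain suffices. *)
Lemma adjoint_graphE f h : adjoint_graph T (f, h) <-> dom T f /\ h = T f.
Proof. by case: Tsa => _ ->. Qed.

Lemma app_l2 f : dom T f -> l2 (T f).
Proof. by move=> df; have [] : adjoint_graph T (f, T f) by apply/adjoint_graphE. Qed.

Lemma app_sym f g : dom T f -> dom T g -> l2dot (T f) g = l2dot f (T g).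
Proof.
move=> df dg; have [_ _ H] : adjoint_graph T (g, T g) by apply/adjoint_graphE.
exact: H.
Qed.

Lemma dom_lin a f g : dom T f -> dom T g -> dom T (a *: f + g).
Proof. by move=> df dg; have [] := Tlin a df dg. Qed.

Lemma domZ a f : dom T f -> dom T (a *: f).
Proof.
move=> df; rewrite (_ : a *: f = (a - 1) *: f + f); first exact: dom_lin.
by rewrite scalerBl scale1r subrK.
Qed.

Lemma domD f g : dom T f -> dom T g -> dom T (f + g).
Proof. by move=> df dg; rewrite -[f]scale1r; exact: dom_lin. Qed.

Lemma domB f g : dom T f -> dom T g -> dom T (f - g).
Proof. by move=> df dg; rewrite -scaleN1r; apply: domD => //; exact: domZ. Qed.

Lemma shiftE z f : shift T z f = T f - z *: f.
Proof. by []. Qed.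

Lemma shift_l2 z f : dom T f -> l2 (shift T z f).
Proof.
move=> df; rewrite shiftE; apply: l2B; first exact: app_l2.
by apply: l2Z; exact: dom_l2.
Qed.

Lemma shift_lin z a f g : dom T f -> dom T g ->
  shift T z (a *: f + g) = a *: shift T z f + shift T z g.
Proof.
move=> df dg; rewrite !shiftE; have [_ ->] := Tlin a df dg.
by rewrite scalerDr scalerBr !scalerA [z * a]mulrC opprD addrACA.
Qed.

Lemma shiftZ z a f : dom T f -> shift T z (a *: f) = a *: shift T z f.
Proof.
move=> df; rewrite -[in RHS](subrK 1 a) scalerDl scale1r -shift_lin//.
by rewrite -[in RHS](scale1r f) scalerA mulr1 -scalerDl subrK.
Qed.

Lemma shiftD z f g : dom T f -> dom T g ->
  shift T z (f + g) = shift T z f + shift T z g.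
Proof. by move=> df dg; rewrite -[in LHS](scale1r f) shift_lin// scale1r. Qed.

Lemma shiftB z f g : dom T f -> dom T g ->
  shift T z (f - g) = shift T z f - shift T z g.
Proof.
move=> df dg; rewrite -[in LHS]scaleN1r shiftD//; last exact: domZ.
by rewrite shiftZ// scaleN1r.
Qed.

Lemma shift_shift z a f : shift T (z + a) f = shift T z f - a *: f.
Proof. by rewrite !shiftE scalerDl opprD addrA. Qed.

Lemma shift_sym z f g : dom T f -> dom T g ->
  l2dot (shift T z f) g = l2dot f (shift T z g).
Proof.
move=> df dg; have lf := dom_l2 df; have lg := dom_l2 dg.
have lTf := app_l2 df; have lTg := app_l2 dg.
rewrite !shiftE l2dotDl//; last by apply/l2N/l2Z.
rewrite l2dotDr//; last by apply/l2N/l2Z.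
by rewrite l2dotNl l2dotNr l2dotZl// l2dotZr// app_sym.
Qed.

Lemma resolvent_surj z h : resolvent_set T z -> l2 h ->
  exists2 g, dom T g & shift T z g = h.
Proof. by move=> [[_ _ H] _] /H [g dg e]; exists g. Qed.

Lemma resolvent_inj z f g : resolvent_set T z -> dom T f -> dom T g ->
  shift T z f = shift T z g -> f = g.
Proof. by move=> [[_ inj _] _] df dg; apply: inj; exact: mem_set. Qed.

Lemma resolvent_bound z : resolvent_set T z ->
  exists2 C, 0 < C & forall f, dom T f -> l2sq f <= C * l2sq (shift T z f).
Proof.
(* The constant of [resolvent_set] may be negative or zero; [C ^+ 2 + 1] is positive and fits
   squared norms. *)
move=> [_ [C HC]]; exists (C ^+ 2 + 1) => [|f df].
  by have := sqr_ge0 C; lra.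
have := HC f df; rewrite !l2normE.
have f0 := l2sq_ge0 f; have s0 := l2sq_ge0 (shift T z f).
rewrite -{2}(sqr_sqrtr f0) -{2}(sqr_sqrtr s0).
move: (sqrtr_ge0 (l2sq f)) (sqrtr_ge0 (l2sq (shift T z f))).
set a := Num.sqrt _; set b := Num.sqrt _ => a0 b0 ab.
have : a * a <= (C * b) * (C * b) by rewrite ler_pM.
by have := sqr_ge0 b; nra.
Qed.

(* If the form [|(T - z) f|^2 - c^2 |f|^2] is nonnegative and [z - c], [z + c]
   are regular, applying Cauchy-Schwarz to this form, [f] and
   [(T - z - c)^-1 (T - z + c)^-1 f] improves the lower bound. *)
Lemma improve_lower_bound z c : resolvent_set T (z + c) ->
  resolvent_set T (z - c) ->
  (forall f, dom T f -> c ^+ 2 * l2sq f <= l2sq (shift T z f)) ->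
  exists2 e, 0 < e &
    forall f, dom T f -> (c ^+ 2 + e) * l2sq f <= l2sq (shift T z f).
Proof.
move=> rp rm Hc.
have [C1 C10 H1] := resolvent_bound rp.
have [C2 C20 H2] := resolvent_bound rm.
(* [C1 * C2] bounds the squared norm of the product of the two resolvents. Adding 1 makes [C] at
   least its square root, hence a bound for the norm itself. *)
pose C := C1 * C2 + 1.
have C120 : 0 < C1 * C2 by rewrite mulr_gt0.
have C0 : 0 < C by rewrite /C; lra.
have D0 : 0 < C^-1 by rewrite invr_gt0.
exists C^-1 => // f df; have lf := dom_l2 df.
have [g1 dg1 e1] := resolvent_surj rp lf.
have lg1 := dom_l2 dg1.
have [g dg e] := resolvent_surj rm lg1.
have lg := dom_l2 dg.
have ng : l2sq g <= C * C * l2sq f.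
  have := H1 _ dg1; have := H2 _ dg; rewrite e e1 => b2 b1.
  have := ler_wpM2l (ltW C20) b1.
  have : C1 * C2 * l2sq f <= C * C * l2sq f.
    by rewrite ler_wpM2r ?l2sq_ge0// /C; nra.
  lra.
have gf : l2dot g f <= C * l2sq f.
  by rewrite -(ler_pM2l C0); have := l2dot_AMGM C lg lf; lra.
have Ag : shift T z g = g1 - c *: g.
  by rewrite -e shift_shift scaleNr opprK addrK.
have dAg : dom T (shift T z g).
  by rewrite Ag; apply: domB => //; exact: domZ.
have AAg : shift T z (shift T z g) = f + c ^+ 2 *: g.
  rewrite Ag shiftB//; last exact: domZ.
  rewrite shiftZ// Ag -e1 shift_shift scalerBr scalerA -expr2.
  by rewrite opprD opprK addrA.
have b1 : l2dot (shift T z f) (shift T z g) = l2sq f + c ^+ 2 * l2dot f g.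
  by rewrite shift_sym// AAg l2dotDr ?l2dotZr//; exact: l2Z.
have b2 : l2sq (shift T z g) = l2dot g f + c ^+ 2 * l2sq g.
  by rewrite {1}/l2sq shift_sym// AAg l2dotDr ?l2dotZr//; exact: l2Z.
(* Let Q be the form |A f|^2 - c^2 |f|^2. Since (A^2 - c^2) g = f, Q(f, g) = |f|^2 and Q(g, g) = <g,
   f> <= C |f|^2. Then Q >= 0 at f - g / C gives Q(f, f) >= (2 / C - 1 / C) |f|^2. *)
have := Hc (f - C^-1 *: g) (domB df (domZ _ dg)).
rewrite shiftB ?shiftZ//; last exact: domZ.
have lsf := shift_l2 z df; have lsg := shift_l2 z dg.
rewrite (l2sqBE lsf (l2Z _ lsg)) (l2sqBE lf (l2Z _ lg)).
rewrite (l2sqZ _ lsg) (l2sqZ _ lg) (l2dotZr _ lsf lsg) (l2dotZr _ lf lg) b1 b2.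
have : C^-1 ^+ 2 * l2dot g f <= C^-1 * l2sq f.
  have := ler_wpM2l (exprn_ge0 2 (ltW D0)) gf.
  by rewrite expr2 mulrA [C^-1 * C^-1 * C](mulfVK (lt0r_neq0 C0)).
lra.
Qed.

(** The supremum s of the admissible constants is itself admissible. If s < r^2, the points z + sqrt
    s and z - sqrt s are still regular, and [improve_lower_bound] goes beyond s. *)
Lemma resolvent_dist z r : 0 < r ->
  (forall w, `|w - z| < r -> resolvent_set T w) ->
  forall f, dom T f -> r ^+ 2 * l2sq f <= l2sq (shift T z f).
Proof.
move=> r0 Hres.
(* The cap [r ^+ 2] keeps [S] bounded even if the domain is trivial. *)
pose S : set R := [set s | [/\ 0 <= s, s <= r ^+ 2 &
  forall f, dom T f -> s * l2sq f <= l2sq (shift T z f)]].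
have S0 : S 0.
  split => // [|f df]; first exact: sqr_ge0.
  by rewrite mul0r l2sq_ge0.
have Sub : has_ubound S by exists (r ^+ 2) => s [].
have Ssup : has_sup S by split => //; exists 0.
pose s := sup S.
have s0 : 0 <= s by apply: ub_le_sup.
have sr : s <= r ^+ 2 by apply: ge_sup; [exists 0|move=> t []].
have Hs f : dom T f -> s * l2sq f <= l2sq (shift T z f).
  move=> df; have [->|f0] := eqVneq (l2sq f) 0; first by rewrite mulr0 l2sq_ge0.
  have {}f0 : 0 < l2sq f by rewrite lt_neqAle eq_sym f0 l2sq_ge0.
  rewrite -ler_pdivlMr//; apply: ge_sup; first by exists 0.
  by move=> t [_ _ Ht]; rewrite ler_pdivlMr//; exact: Ht.
have [sr'|] := ltP s (r ^+ 2); last first.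
  by move=> rs f df; apply: le_trans (Hs f df); rewrite ler_wpM2r ?l2sq_ge0.
pose c := Num.sqrt s.
have c0 : 0 <= c by exact: sqrtr_ge0.
have cs : c ^+ 2 = s by rewrite sqr_sqrtr.
have cr : c < r by rewrite ltNge; apply/negP => rc; move: sr'; rewrite -cs; nra.
have [| | |e e0 He] := @improve_lower_bound z c.
- by apply: Hres; rewrite addrAC subrr add0r ger0_norm.
- by apply: Hres; rewrite addrAC subrr add0r normrN ger0_norm.
- by rewrite cs.
have : S (s + Num.min e (r ^+ 2 - s)).
  have m0 : 0 <= Num.min e (r ^+ 2 - s) by rewrite le_min (ltW e0) subr_ge0.
  split; first by rewrite addr_ge0.
    by rewrite -lerBrDl ge_min lexx orbT.
  move=> f df; apply: le_trans (He f df); rewrite cs ler_wpM2r ?l2sq_ge0//.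
  by rewrite lerD2l ge_min lexx.
move=> /(ub_le_sup Sub); rewrite -/s gerDl leNgt lt_min e0 subr_gt0 sr'.
by [].
Qed.

End SelfAdjointOperator.

(** * Isolated spectral points *)

Section IsolatedPoint.
Context (R : realType) (X : choiceType) (T : operator R X) (mu r : R).
Implicit Types (f g h k y : X -> R) (t s : R).
Context (Tlin : linear_operator T) (Tsa : self_adjoint T) (r0 : 0 < r)
  (mu_isolated : forall z, z != mu -> `|z - mu| < r -> resolvent_set T z).

Local Notation A := (shift T mu).

(** The spectrum of A lies where a = 0 or |a| >= r, and there a^2 >= r |a|. Concretely, the open
    balls of radius r / 2 about mu + r / 2 and mu - r / 2 are regular, and expanding
    [resolvent_dist] at their centres cancels the terms in |f|^2. *)
Lemma isolated_form_le f : dom T f -> r * `|l2dot (A f) f| <= l2sq (A f).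
Proof.
move=> df; have lf := dom_l2 Tsa df; have lAf := shift_l2 Tsa mu df.
have r2 : 0 < r / 2 by rewrite divr_gt0.
have H (a : R) : `|a| = r / 2 -> 0 <= l2sq (A f) - 2 * (a * l2dot (A f) f).
  move=> ar.
  have reg w : `|w - (mu + a)| < r / 2 -> resolvent_set T w.
    move=> wr; apply: mu_isolated.
      apply/eqP => e; move: wr.
      by rewrite e opprD addrA subrr add0r normrN ar ltxx.
    rewrite (_ : w - mu = (w - (mu + a)) + a); last by ring.
    apply: le_lt_trans (ler_normD _ _) _.
    by rewrite ar; lra.
  have := resolvent_dist Tlin Tsa r2 reg df.
  rewrite shift_shift (l2sqBE lAf (l2Z a lf)).
  rewrite (l2dotZr _ lAf lf) (l2sqZ _ lf) -[a ^+ 2]real_normK ?num_real// ar; lra.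
have := H (r / 2) ltac:(by rewrite gtr0_norm).
have := H (- (r / 2)) ltac:(by rewrite normrN gtr0_norm).
by case: (ger0P (l2dot (A f) f)) => _; lra.
Qed.

(* On [{0} \/ {|a| >= r}], [2 a^2 (a^2 - r^2)] equals
   [(a + r)^2 (a^2 - r a) + (a - r)^2 (a^2 + r a)]. *)
Lemma isolated_range_lower_bound k : dom T k -> dom T (A k) ->
  r ^+ 2 * l2sq (A k) <= l2sq (A (A k)).
Proof.
move=> dk dAk; have lk := dom_l2 Tsa dk; have lAk := dom_l2 Tsa dAk.
have lAAk := shift_l2 Tsa mu dAk.
have kAAk : l2dot (A (A k)) k = l2sq (A k) by rewrite shift_sym.
(* This expands |A y|^2 - a <A y, y> for y = A k + a k. Adding the cases a = r and a = -r cancels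
   the odd powers of a. *)
have H (a : R) : `|a| = r -> 0 <= l2sq (A (A k)) + a * l2dot (A (A k)) (A k)
    - r ^+ 2 * l2sq (A k) - a ^+ 3 * l2dot (A k) k.
  move=> ar.
  have a2 : a ^+ 2 = r ^+ 2 by rewrite -real_normK ?num_real// ar.
  have dak : dom T (a *: k) by exact: domZ.
  have dy : dom T (A k + a *: k) by exact: domD.
  have := isolated_form_le dy.
  rewrite (shiftD Tlin _ dAk dak) (shiftZ Tlin _ _ dk).
  have laAk := l2Z a lAk; have lak := l2Z a lk.
  rewrite (l2sqDE lAAk laAk) (l2dotZr _ lAAk lAk) (l2sqZ _ lAk).
  rewrite (l2dotDl lAAk laAk (l2D lAk lak)).
  rewrite (l2dotDr lAk lak lAAk) (l2dotDr lAk lak laAk).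
  rewrite (l2dotZr _ lAAk lk) (l2dotZl _ lAk lAk) (l2dotZl _ lAk lak).
  rewrite (l2dotZr _ lAk lk) kAAk -/(l2sq (A k)).
  set d := _ + (_ + _) => He.
  have : a * d <= r * `|d| by rewrite -ar -normrM ler_norm.
  rewrite -a2 /d; move: He; lra.
have := H r ltac:(by rewrite gtr0_norm).
have := H (- r) ltac:(by rewrite normrN gtr0_norm).
lra.
Qed.

(** By [isolated_form_le] the cross term 2 t <A y, y> is at most (2 t / r) |A y|^2, which is half of
    |A y|^2 when t <= r / 4. *)
Lemma isolated_shift_le t y : 0 < t -> t <= r / 4 -> dom T y ->
  l2sq (A y) <= 2 * l2sq (A y - t *: y).
Proof.
move=> t0 tr dy; have ly := dom_l2 Tsa dy; have lAy := shift_l2 Tsa mu dy.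
rewrite (l2sqBE lAy (l2Z t ly)) (l2dotZr _ lAy ly) (l2sqZ _ ly).
have := isolated_form_le dy; have := ler_norm (l2dot (A y) y).
have := normr_ge0 (l2dot (A y) y).
set n := `|_|; set d := l2dot _ _; move: (l2sq_ge0 y) => y0 n0 dn rn.
have : 0 <= t ^+ 2 * l2sq y by rewrite mulr_ge0// sqr_ge0.
have : t * d <= r / 4 * n.
  apply: le_trans (_ : t * n <= _); first by rewrite ler_pM2l.
  by rewrite ler_wpM2r.
lra.
Qed.

(** Here k = (A - s)^-1 (A - t)^-1 f is a difference quotient of resolvents. It may blow up along
    the kernel of A, but A k does not: r^2 |A k|^2 <= |A (A k)|^2 <= 2 |A y|^2 <= 4 |f|^2. *)
Lemma isolated_resolvent_diff t s y k : 0 < t -> t <= r / 4 ->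
  0 < s -> s <= r / 4 -> dom T y -> dom T k -> A k - s *: k = y ->
  l2sq (A k) <= 4 / r ^+ 2 * l2sq (A y - t *: y).
Proof.
move=> t0 tr s0 sr dy dk ky.
have Ak : A k = y + s *: k by rewrite -ky subrK.
have dsk : dom T (s *: k) by exact: domZ.
have dAk : dom T (A k) by rewrite Ak; exact: domD.
have Ay : A y = A (A k) - s *: A k by rewrite -ky shiftB// shiftZ.
have := isolated_shift_le t0 tr dy.
have := isolated_shift_le s0 sr dAk; rewrite -Ay.
have := isolated_range_lower_bound dk dAk.
rewrite -mulrA [_^-1 * _]mulrC mulrA ler_pdivlMr ?exprn_gt0//.
lra.
Qed.

(** With t_n = t / (n + 1) and y_n = (A - t_n)^-1 f, the functions p_n = t_n y_n converge with an
    explicit rate to minus the projection of f to the eigenspace. This limit is 0 by orthogonality,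
    so the rate at n = 0 bounds t y_0. *)
Lemma isolated_resolvent_le t f : 0 < t -> t <= r / 4 -> l2 f ->
  (forall v, eigenspace_of T mu v -> l2dot f v = 0) ->
  exists y, [/\ dom T y, A y - t *: y = f & l2sq y <= 8 / r ^+ 2 * l2sq f].
Proof.
move=> t0 tr lf fE.
pose tn n : R := t / n.+1%:R.
have n0 n : 0 < n.+1%:R :> R by rewrite ltr0n.
have tn0 n : 0 < tn n by rewrite divr_gt0.
have tnt n : tn n <= t.
  by rewrite ler_pdivrMr// ler_peMr ?(ltW t0)// ler1n.
have tnr n : tn n <= r / 4 by exact: le_trans (tnt n) tr.
have tn_le n m : (n <= m)%N -> tn m <= tn n.
  by move=> nm; rewrite ler_wpM2l ?(ltW t0)// lef_pV2 ?posrE// ler_nat.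
have reg n : resolvent_set T (mu + tn n).
  apply: mu_isolated.
    by rewrite -subr_eq0 addrAC subrr add0r gt_eqF.
  by rewrite addrAC subrr add0r gtr0_norm//; have := tnr n; move: r0; lra.
have [y yP] : {y : nat -> X -> R &
    forall n, dom T (y n) /\ A (y n) - tn n *: y n = f}.
  apply: (@choice _ _ (fun n y => dom T y /\ A y - tn n *: y = f)) => n.
  by have [g dg] := resolvent_surj (reg n) lf; rewrite shift_shift; exists g.
have dy n : dom T (y n) by have [] := yP n.
have Ay n : A (y n) = f + tn n *: y n by have [_ <-] := yP n; rewrite subrK.
have ly n : l2 (y n) by exact: (dom_l2 Tsa).
pose p n := tn n *: y n.
have lp n : l2 (p n) by exact: l2Z.
have tn_small K e n : 0 <= K -> 0 < e -> exists2 m, (n <= m)%N & tn m ^+ 2 * K <= e.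
  move=> K0 e0; pose b := Num.bound (t ^+ 2 * K / e).
  have bP : t ^+ 2 * K / e < b%:R.
    by apply: archi_boundP; rewrite divr_ge0 ?(ltW e0)// mulr_ge0// sqr_ge0.
  exists (maxn n b); first exact: leq_maxl.
  set m := maxn n b; have mb : b%:R <= m.+1%:R :> R.
    by rewrite ler_nat leqW// leq_maxr.
  have m1 : 1 <= m.+1%:R :> R by rewrite ler1n.
  rewrite /tn expr_div_n mulrAC ler_pdivrMr ?exprn_gt0//.
  move: bP; rewrite ltr_pdivrMr// => bP.
  apply: le_trans (ltW bP) _; rewrite mulrC ler_pM2l//.
  by apply: le_trans mb _; rewrite expr2 ler_peMr.
have tn_squeeze K a : 0 <= K -> (forall n, a <= tn n ^+ 2 * K) -> a <= 0.
  move=> K0 aK; apply/ler_addgt0Pl => e e0.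
  by have [m _ me] := tn_small K e 0%N K0 e0; rewrite addr0 (le_trans (aK m)).
set C := 4 / r ^+ 2 * l2sq f.
have C0 : 0 <= C by rewrite mulr_ge0 ?l2sq_ge0// divr_ge0// sqr_ge0.
have pB n m : (n <= m)%N -> l2sq (p m - p n) <= tn n ^+ 2 * C.
  move=> nm.
  (* Resolvent identity: y m - y n = (tn m - tn n) k. Applying A gives p m - p n, because A (y n) =
     f + p n. *)
  have [k dk] := resolvent_surj (reg m) (ly n).
  rewrite shift_shift => ky; have lAk := shift_l2 Tsa mu dk.
  have dzk : dom T ((tn m - tn n) *: k) by exact: domZ.
  have yB : y m = y n + (tn m - tn n) *: k.
    apply: (resolvent_inj (reg m)) => //; first exact: domD.
    rewrite shiftD ?shiftZ//.
    by rewrite !shift_shift ky !Ay addrK scalerBl addrA subrK addrK.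
  have -> : p m - p n = (tn m - tn n) *: A k.
    rewrite -shiftZ// (_ : _ *: k = y m - y n); last by rewrite yB addrAC subrr add0r.
    by rewrite shiftB// !Ay opprD addrACA subrr add0r.
  rewrite l2sqZ//; apply: ler_pM.
  - exact: sqr_ge0.
  - exact: l2sq_ge0.
  - have := tn_le n m nm; have := tn0 m; have := tn0 n; nra.
  - rewrite /C; have [_ <-] := yP n.
    exact: (isolated_resolvent_diff (tn0 n) (tnr n) (tn0 m) (tnr m)).
have [||q lq qp] := @l2_complete _ _ p (fun n => tn n ^+ 2 * C) lp.
- by move=> e n e0; exact: tn_small.
- exact: pB.
have Ap n : A (p n) = tn n *: A (y n) by rewrite shiftZ.
have qE : eigenspace_of T mu q.
  (* Self-adjointness reduces this to <A h, q> = 0 for h in the domain. Now <A h, q> = <A h, q - p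
     n> + tn n <h, A (y n)>, and both terms tend to 0. *)
  have [dq e] : dom T q /\ mu *: q = T q.
    apply/(adjoint_graphE Tsa); split => //=; first exact: l2Z.
    move=> h dh; have lh := dom_l2 Tsa dh; have lTh := app_l2 Tsa dh.
    have lAh := shift_l2 Tsa mu dh.
    suff : l2dot (A h) q = 0.
      rewrite shiftE (l2dotDl lTh (l2N (l2Z _ lh)) lq) l2dotNl.
      by rewrite (l2dotZl _ lh lq) (l2dotZr _ lh lq) => /eqP; rewrite subr_eq0 => /eqP.
    apply/eqP; rewrite -(@sqrf_eq0 R) eq_le sqr_ge0 andbT.
    apply: (@tn_squeeze (l2sq (A h) * (4 * C) + l2sq h * (4 * l2sq f))).
      by apply: addr_ge0; (apply: mulr_ge0; [exact: l2sq_ge0|]);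
        apply: mulr_ge0 => //; exact: l2sq_ge0.
    move=> n; have lqp : l2 (q - p n) by exact: l2B.
    have lAy := shift_l2 Tsa mu (dy n).
    rewrite -[q](subrK (p n)) (l2dotDr lqp (lp n) lAh).
    rewrite (shift_sym Tsa mu dh (domZ Tlin _ (dy n))).
    rewrite Ap (l2dotZr _ lh lAy).
    have i1 := l2dot_CS lAh lqp; have i2 := l2dot_CS lh lAy.
    have i3 := ler_wpM2l (l2sq_ge0 (A h)) (qp n).
    have := isolated_shift_le (tn0 n) (tnr n) (dy n).
    have [_ ->] := yP n => /(ler_wpM2l (l2sq_ge0 h)) i4.
    move: i1 i2; set d := l2dot _ _; set d' := l2dot _ _ => i1 i2.
    have : tn n ^+ 2 * d' ^+ 2 <= tn n ^+ 2 * (l2sq h * (2 * l2sq f)).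
      by rewrite ler_wpM2l ?sqr_ge0// (le_trans i2).
    have := le_trans i1 i3.
    by have := sqr_ge0 (d - tn n * d'); lra.
  by split => // x; rewrite -e.
have q0 : q = 0.
  apply: l2sq_eq0 => //; apply/eqP; rewrite -(@sqrf_eq0 R) eq_le sqr_ge0 andbT.
  apply: (@tn_squeeze (2 * C * l2sq q)) => [|n].
    by rewrite mulr_ge0 ?l2sq_ge0// mulr_ge0.
  (* Symmetry makes A (y n) = f + p n orthogonal to the eigenfunction q, and f already is. *)
  have pq : l2dot (p n) q = 0.
    have [dq Tq] := qE.
    have Aq : A q = 0 by apply/funext => x; rewrite /shift Tq subrr.
    have : l2dot (A (y n)) q = 0 by rewrite shift_sym// Aq l2dotC l2dot0l.
    by rewrite Ay (l2dotDl lf (lp n) lq) fE// add0r.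
  have {1}-> : l2sq q = l2dot (q - p n) q.
    by rewrite (l2dotDl lq (l2N (lp n)) lq) l2dotNl pq oppr0 addr0.
  apply: le_trans (l2dot_CS (l2B lq (lp n)) lq) _.
  by rewrite mulrA ler_wpM2r ?l2sq_ge0// (le_trans (qp n))// mulrCA.
exists (y 0%N); split => //.
  by have [_] := yP 0%N; rewrite /tn divr1.
(* At index 0 the rate reads |t y|^2 <= 2 t^2 C, and 2 C is the asserted bound. *)
have := qp 0%N; rewrite q0 sub0r l2sqN l2sqZ// /tn divr1 [2 * _]mulrCA.
rewrite ler_pM2l ?exprn_gt0// /C; lra.
Qed.

End IsolatedPoint.

(** * Finite-dimensional eigenspaces *)

Section FiniteDimensional.
Context (R : realType) (X : choiceType) (V : set (X -> R)).
Implicit Types (f g w : X -> R).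
Context (V_l2 : V `<=` l2) (V0 : V 0)
  (V_lin : forall a f g, V f -> V g -> V (a *: f + g))
  (V_fin : finite_dimensional V).

Definition orthonormal_in k (v : 'I_k -> X -> R) : Prop :=
  (forall i, V (v i)) /\ forall i j, l2dot (v i) (v j) = (i == j)%:R.

Lemma subspace_sum k (c : 'I_k -> R) (v : 'I_k -> X -> R) : (forall i, V (v i)) ->
  V (\sum_i c i *: v i).
Proof.
move=> Vv; elim/big_rec: _ => [|i w _ Vw]; first exact: V0.
exact: V_lin.
Qed.

Lemma orthonormal_dot k (v : 'I_k -> X -> R) (c : 'I_k -> R) j :
  orthonormal_in v -> l2dot (\sum_i c i *: v i) (v j) = c j.
Proof.
move=> [Vv vv]; have lv i : l2 (v i) by apply: V_l2.
rewrite l2dot_suml//; last by move=> i; exact: l2Z.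
rewrite (bigD1 j)//= l2dotZl// vv eqxx mulr1 big1 ?addr0// => i ij.
by rewrite l2dotZl// vv (negPf ij) mulr0.
Qed.

(** The spanning functions of [finite_dimensional] need not lie in [V] or in [l2], so they cannot be
    orthonormalized; they only bound the dimension. If k > n, the matrix of coefficients has a
    nonzero left kernel vector, and the relation it yields between the [v i] contradicts
    orthonormality. *)
Lemma orthonormal_size : exists n, forall k (v : 'I_k -> X -> R),
  orthonormal_in v -> (k <= n)%N.
Proof.
have [n [e He]] := V_fin; exists n => k v ov.
have [Vv _] := ov.
have [c cP] := choice (fun i => He _ (Vv i)).
rewrite leqNgt; apply/negP => nk.
pose M : 'M[R]_(k, n) := \matrix_(i, j) c i j.
have : kermx M != 0.
  by rewrite -mxrank_eq0 mxrank_ker -lt0n subn_gt0 (leq_ltn_trans (rank_leq_col M)).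
move=> /rowV0Pn[a /sub_kermxP aM /negP]; apply.
apply/eqP/rowP => j; rewrite mxE -(orthonormal_dot (fun i => a 0 i) j ov).
rewrite (_ : \sum_i _ = 0) ?l2dot0l//.
apply/funext => x; rewrite fct_sumE.
have -> : \sum_(i < k) (a 0 i *: v i) x = \sum_(i < k) \sum_(l < n) a 0 i * M i l * e l x.
  apply: eq_bigr => i _; rewrite fctE /GRing.scale /= cP mulr_sumr.
  by apply: eq_bigr => l _; rewrite mxE mulrA.
rewrite exchange_big big1// => l _; rewrite -mulr_suml.
by have /matrixP/(_ 0 l) := aM; rewrite !mxE => ->; rewrite mul0r.
Qed.

Lemma orthonormal_extend k (v : 'I_k -> X -> R) w : orthonormal_in v ->
  V w -> (forall i, l2dot w (v i) = 0) -> w != 0 ->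
  exists v' : 'I_k.+1 -> X -> R, orthonormal_in v'.
Proof.
move=> [Vv vv] Vw wv w0; have lw := V_l2 Vw.
have {}w0 : 0 < l2sq w.
  rewrite lt_neqAle l2sq_ge0 andbT eq_sym; apply: contraNneq w0.
  by move=> /(l2sq_eq0 lw) ->.
pose s := Num.sqrt (l2sq w).
have s2 : s ^+ 2 = l2sq w by rewrite sqr_sqrtr// ltW.
have s0 : s != 0 by rewrite sqrtr_eq0 -ltNge.
pose z := s^-1 *: w.
have Vz : V z by rewrite /z -[_ *: w]addr0; exact: V_lin.
have zv i : l2dot z (v i) = 0.
  by rewrite /z l2dotZl ?wv ?mulr0//; exact: V_l2.
have zz : l2dot z z = 1.
  rewrite -/(l2sq z) /z l2sqZ// -s2 -exprMn mulVf// expr1n//.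
exists (fun i => if unlift ord_max i is Some j then v j else z); split.
  by move=> i; case: unliftP.
move=> i j; case: unliftP => [i' ->|->]; case: unliftP => [j' ->|->].
- by rewrite vv (inj_eq lift_inj).
- by rewrite l2dotC zv eq_sym (negPf (neq_lift _ _)).
- by rewrite zv (negPf (neq_lift _ _)).
- by rewrite zz eqxx.
Qed.

(** An orthonormal family of maximal size spans, since otherwise the remainder of some [w] would
    extend it. The family is fixed before [f], so the projection of [f] is small as soon as finitely
    many prescribed inner products are. *)
Lemma orthogonal_projection : exists k (v : 'I_k -> X -> R),
  (forall i, l2 (v i)) /\ forall f, l2 f -> exists s,
    [/\ V s, l2sq s = \sum_(i < k) l2dot (v i) f ^+ 2 &
        forall w, V w -> l2dot (f - s) w = 0].
Proof.
pose P k := `[< exists v : 'I_k -> X -> R, orthonormal_in v >].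
have P0 : exists k, P k.
  by exists 0%N; apply/asboolP; exists (fun=> 0); split; case.
have [n nP] := orthonormal_size.
have Pn k : P k -> (k <= n)%N by move=> /asboolP[v /nP].
case: (ex_maxnP P0 Pn) => k /asboolP[v ov] kmax.
have [Vv vv] := ov; have lv i : l2 (v i) by apply: V_l2.
exists k, v; split => // f lf.
pose s := \sum_(i < k) l2dot f (v i) *: v i.
have Vs : V s by exact: subspace_sum.
have ls := V_l2 Vs.
have fsv i : l2dot (f - s) (v i) = 0.
  by rewrite (l2dotDl lf (l2N ls) (lv i)) l2dotNl /s orthonormal_dot// subrr.
have span w : V w -> w = \sum_(i < k) l2dot w (v i) *: v i.
  move=> Vw; apply/eqP; rewrite -subr_eq0; apply/negPn/negP => r0.
  set s' := \sum_i _ in r0.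
  have Vs' : V s' by exact: subspace_sum.
  have lw := V_l2 Vw; have ls' := V_l2 Vs'.
  have Vr : V (w - s').
    by rewrite addrC -scaleN1r; exact: V_lin.
  have [|v' ov'] := orthonormal_extend ov Vr _ r0.
    by move=> i; rewrite (l2dotDl lw (l2N ls') (lv i)) l2dotNl /s' orthonormal_dot// subrr.
  have : (k.+1 <= k)%N by apply: kmax; apply/asboolP; exists v'.
  by rewrite ltnn.
have dot_span h c : l2 h -> l2dot h (\sum_(i < k) c i *: v i) =
    \sum_(i < k) c i * l2dot h (v i).
  move=> lh; rewrite l2dotC l2dot_suml//; last by move=> i; exact: l2Z.
  by apply: eq_bigr => i _; rewrite l2dotZl// l2dotC.
exists s; split => //.
  rewrite /l2sq {2}/s dot_span//; apply: eq_bigr => i _.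
  by rewrite /s orthonormal_dot// l2dotC expr2.
move=> w /span ->; rewrite dot_span; last exact: l2B.
by rewrite big1// => i _; rewrite fsv mulr0.
Qed.

End FiniteDimensional.

(** * The resolvent on functions supported far away *)

Section Gap.
Context (R : realType) (X : choiceType) (T : operator R X).
Implicit Types (f g h : X -> R) (mu t : R) (K : set X).
Context (Tlin : linear_operator T) (Tsa : self_adjoint T).

(** Density provides some element of the domain, which linearity alone does not. *)
Lemma dom0 : dom T 0.
Proof.
have [[_ dd] _] := Tsa.
have [f df _] := dd 0 (@l2_0 R X) 1 ltr01.
by rewrite -(scale0r f); exact: domZ.
Qed.

Lemma eigenspace_shift mu f :
  eigenspace_of T mu f <-> dom T f /\ shift T mu f = 0.
Proof.
split=> -[df H]; split => //.
  by apply/funext => x; rewrite /shift H subrr.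
by move=> x; apply/eqP; rewrite -subr_eq0; apply/eqP; exact: (congr1 (@^~ x) H).
Qed.

Lemma eigenspace_lin mu a f g : eigenspace_of T mu f -> eigenspace_of T mu g ->
  eigenspace_of T mu (a *: f + g).
Proof.
move=> /eigenspace_shift[df Hf] /eigenspace_shift[dg Hg]; apply/eigenspace_shift.
by split; [exact: dom_lin|rewrite shift_lin// Hf Hg scaler0 addr0].
Qed.

Lemma eigenspace0 mu : eigenspace_of T mu 0.
Proof.
apply/eigenspace_shift; split; first exact: dom0.
by have := shiftZ Tlin mu 0 dom0; rewrite !scale0r.
Qed.

Lemma discrete_radius mu : discrete_spectrum T mu -> exists2 r, 0 < r &
  forall z, z != mu -> `|z - mu| < r -> resolvent_set T z.
Proof.
move=> dmu; have [iso _ _] := dmu; have [_ [U nbU UE]] := iso.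
have [r /= r0 rU] := (nbhs_ballP _ _).1 nbU.
exists r => // z zmu zr.
apply: contrapT => nz.
have : (U `&` spectrum T) z.
  by split => //; apply: rU; rewrite /ball/= distrC.
by rewrite UE => /= e; rewrite e eqxx in zmu.
Qed.

Lemma l2_tail_family k (v : 'I_k -> X -> R) e : (forall i, l2 (v i)) -> 0 < e ->
  exists2 K, finite_set K & forall f, l2 f -> (forall x, K x -> f x = 0) ->
    forall i, l2dot (v i) f ^+ 2 <= e * l2sq f.
Proof.
move=> lv e0.
have [F FP] : {F : 'I_k -> set X & forall i, finite_set (F i) /\
    forall f, l2 f -> (forall x, F i x -> f x = 0) ->
    l2dot (v i) f ^+ 2 <= e * l2sq f}.
  apply: (@choice _ _ (fun i K => finite_set K /\ forall f, l2 f ->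
    (forall x, K x -> f x = 0) -> l2dot (v i) f ^+ 2 <= e * l2sq f)) => i.
  by have [K finK HK] := l2_tail (lv i) e0; exists K.
exists (\bigcup_(i in [set: 'I_k]) F i).
  by apply: bigcup_finite => // i _; have [] := FP i.
move=> f lf f0 i; have [_ H] := FP i; apply: H => // x Fx.
by apply: f0; exists i.
Qed.

(* Functions supported far away are almost orthogonal to the finite-dimensional
   eigenspace, the only place where the resolvent blows up near [mu]. *)
Lemma resolvent_bound_far mu : ~ essential_spectrum T mu ->
  exists2 C, 0 < C & forall e, 0 < e -> exists t, [/\ `|t| < e,
    resolvent_set T (mu + t) & exists2 K, finite_set K &
    forall f g, l2 f -> (forall x, K x -> f x = 0) -> dom T g ->
      shift T (mu + t) g = f -> l2sq g <= C * l2sq f].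
Proof.
move=> ness; have [res|nres] := pselect (resolvent_set T mu).
  have [C C0 HC] := resolvent_bound res.
  exists C => // e e0; exists 0; rewrite addr0 normr0; split => //.
  by exists set0 => // f g lf _ dg <-; exact: HC.
have dmu : discrete_spectrum T mu by apply: contrapT => nd; apply: ness.
have [r r0 Hr] := discrete_radius dmu.
have [_ _ fd] := dmu.
have E_l2 : eigenspace_of T mu `<=` l2 by move=> f [df _]; exact: (dom_l2 Tsa).
have [k [v [lv Hv]]] := orthogonal_projection E_l2 (eigenspace0 mu)
  (@eigenspace_lin mu) fd.
have r20 : 0 <= 8 / r ^+ 2 by rewrite divr_ge0// sqr_ge0.
(* The two terms bound 2 |y|^2 and 2 |s / t|^2 for the splitting of g below; neither depends on
   t. *)
exists (2 * (8 / r ^+ 2) + 2) => [|e e0]; first by lra.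
pose t := Num.min (e / 2) (r / 4).
have t0 : 0 < t by rewrite lt_min !divr_gt0.
have te : t < e by rewrite gt_min; apply/orP; left; lra.
have tr : t <= r / 4 by rewrite ge_min lexx orbT.
have k0 : 0 < k.+1%:R :> R by rewrite ltr0n.
have res : resolvent_set T (mu + t).
  apply: Hr; first by rewrite -subr_eq0 addrAC subrr add0r gt_eqF.
  by rewrite addrAC subrr add0r gtr0_norm//; lra.
exists t; split => //; first by rewrite gtr0_norm.
(* Summing over the k basis functions gives |s|^2 <= t^2 |f|^2, which absorbs the factor 1 / t. The
   denominator k + 1 covers a trivial eigenspace basis. *)
have [|K finK KP] := l2_tail_family (e := t ^+ 2 / k.+1%:R) lv.
  by rewrite divr_gt0// exprn_gt0.
exists K => // f g lf f0 dg gf.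
have [s [Es s2 sE]] := Hv f lf.
have [ds As] := (eigenspace_shift mu s).1 Es.
have ls := dom_l2 Tsa ds.
have s_small : l2sq s <= t ^+ 2 * l2sq f.
  rewrite s2; apply: le_trans (ler_sum _ (fun i _ => KP f lf f0 i)) _.
  rewrite sumr_const card_ord -[_ *+ k]mulr_natl mulrA ler_wpM2r ?l2sq_ge0//.
  rewrite mulrCA ler_piMr ?sqr_ge0// ler_pdivrMr// mul1r ler_nat//.
have fs : l2sq (f - s) <= l2sq f.
  have : l2dot f s = l2sq s.
    by have /eqP := sE _ Es; rewrite (l2dotDl lf (l2N ls) ls) l2dotNl subr_eq0 => /eqP.
  by rewrite (l2sqBE lf ls) => ->; have := l2sq_ge0 s; lra.
have [y [dy yf ny]] := isolated_resolvent_le Tlin Tsa r0 Hr t0 tr (l2B lf ls) sE.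
have dts : dom T (t^-1 *: s) by exact: domZ.
(* On the eigenspace A - t is multiplication by -t, so the part s of f contributes - s / t. *)
have -> : g = y - t^-1 *: s.
  apply: (resolvent_inj res) => //; first exact: domB.
  rewrite gf shiftB// shiftZ// !shift_shift yf As sub0r scalerN scalerA mulVf ?gt_eqF//.
  by rewrite scale1r opprK subrK.
have ly := dom_l2 Tsa dy.
apply: le_trans (l2sqD_le ly (l2N (l2Z _ ls))) _; rewrite l2sqN l2sqZ//.
have : t^-1 ^+ 2 * l2sq s <= l2sq f.
  by rewrite exprVn mulrC ler_pdivrMr ?exprn_gt0// mulrC.
have := ler_wpM2l r20 fs.
lra.
Qed.

End Gap.

(** * The quadratic form far away *)

Section FarFormBound.
Context (R : realType) (X : choiceType) (T : operator R X).
Implicit Types (f g h w : X -> R) (m mu t z : R) (K : set X).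
Context (Tlin : linear_operator T) (Tsa : self_adjoint T)
  (Tpos : positive_operator T) (dom_dirac : forall x, dom T (dirac1 R x)).

(** The supremum of such m over finite K is the constant that Persson's theorem identifies with the
    bottom of the essential spectrum. *)
Definition form_ge_off K m : Prop := forall f, dom T f ->
  (forall x, K x -> f x = 0) -> m * l2sq f <= l2dot (T f) f.

(** Induction with |a + b|^2 <= 2 |a|^2 + 2 |b|^2. The constant is crude, but only its independence
    of the coefficients matters. *)
Lemma l2sq_sum_le (s : seq X) (F : X -> X -> R) : (forall x, l2 (F x)) ->
  exists2 c : R, 0 <= c & forall (a : X -> R) e,
    (forall x, x \in s -> a x ^+ 2 <= e) ->
    l2sq (\sum_(x <- s) a x *: F x) <= c * e.
Proof.
move=> lF; elim: s => [|y s [c c0 Hc]].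
  by exists 0 => // a e _; rewrite big_nil mul0r /l2sq l2dot0l.
exists (2 * l2sq (F y) + 2 * c) => [|a e ae].
  by rewrite addr_ge0// mulr_ge0// l2sq_ge0.
rewrite big_cons.
have lyF := l2Z (a y) (lF y).
have ls : l2 (\sum_(x <- s) a x *: F x) by apply: l2_sum => x; exact: l2Z.
apply: le_trans (l2sqD_le lyF ls) _; rewrite l2sqZ//.
have := Hc a e (fun x xs => ae x (@mem_behead _ (y :: s) x xs)).
have := ler_wpM2r (l2sq_ge0 (F y)) (ae y (mem_head _ _)).
lra.
Qed.

Lemma dom_shift_sum z (s : seq X) (a : X -> R) (F : X -> X -> R) :
  (forall x, dom T (F x)) -> dom T (\sum_(x <- s) a x *: F x) /\
  shift T z (\sum_(x <- s) a x *: F x) = \sum_(x <- s) a x *: shift T z (F x).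
Proof.
move=> dF; elim: s => [|y s [ds Hs]].
  rewrite !big_nil; split; first exact: dom0.
  by have [_] := (eigenspace_shift T z 0).1 (eigenspace0 Tlin Tsa z).
rewrite !big_cons; split; first exact: dom_lin.
by rewrite shift_lin// Hs.
Qed.

Lemma dom_zero_extend K f : finite_set K -> dom T (zero_extend K f).
Proof.
move=> finK; rewrite zero_extend_sum//.
by have [] := dom_shift_sum 0 (fset_set K) f dom_dirac.
Qed.

(** A restriction to [K] is a finite combination of point masses, on which even an unbounded
    operator is controlled by the coefficients. The scale [c] is left free since it becomes the
    squared norm of a function chosen after [d]. *)
Lemma zero_extend_small z K e : finite_set K -> 0 < e -> exists2 d, 0 < d &
  forall f c, 0 <= c -> (forall x, K x -> f x ^+ 2 <= d * c) ->
    l2sq (zero_extend K f) <= e * c /\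
    l2sq (shift T z (zero_extend K f)) <= e * c.
Proof.
move=> finK e0.
have [c1 c10 H1] := @l2sq_sum_le (fset_set K) _ (l2_dirac1 R (X := X)).
have [c2 c20 H2] := @l2sq_sum_le (fset_set K) _
  (fun x => shift_l2 Tsa z (dom_dirac x)).
have c0 : 0 < c1 + c2 + 1 by lra.
exists (e / (c1 + c2 + 1)) => [|f c cp fd]; first by rewrite divr_gt0.
have fd' x : x \in fset_set K -> f x ^+ 2 <= e / (c1 + c2 + 1) * c.
  by rewrite in_fset_set// => /set_mem; exact: fd.
have [_ sE] := dom_shift_sum z (fset_set K) f dom_dirac.
have ec : 0 <= e * c by rewrite mulr_ge0// ltW.
have le_ec b : 0 <= b -> b <= c1 + c2 + 1 -> b * (e / (c1 + c2 + 1) * c) <= e * c.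
  move=> b0 bc; rewrite mulrAC mulrA ler_pdivrMr// mulrC ler_wpM2l//.
rewrite zero_extend_sum// sE; split.
  by apply: le_trans (H1 _ _ fd') (le_ec _ _ _) => //; lra.
by apply: le_trans (H2 _ _ fd') (le_ec _ _ _) => //; lra.
Qed.

(* Outside the essential spectrum, a function [f] supported far away with form
   close to [mu] could be improved by subtracting a multiple of
   [(T - mu - t)^-1 f], made to vanish on a finite set. *)
Lemma sup_form_essential mu :
  (forall e, 0 < e -> exists2 K, finite_set K & form_ge_off K (mu - e)) ->
  (forall e K, 0 < e -> finite_set K -> ~ form_ge_off K (mu + e)) ->
  essential_spectrum T mu.
Proof.
move=> below above; apply: contrapT => ness.
have [C0 C00 HC0] := resolvent_bound_far Tlin Tsa ness.
pose C := C0 + 1; have C1 : 1 <= C by rewrite /C; lra.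
pose i := C^-1; have Ci : C * i = 1 by rewrite /i divff// gt_eqF//; lra.
have i0 : 0 < i by rewrite invr_gt0; lra.
have i1 : i <= 1 by rewrite invf_le1//; lra.
(* Thus e C = 1 / 100, and errors of size e C |f|^2 are a small share of |f|^2. *)
pose e := i / 100; have e0 : 0 < e by rewrite /e; lra.
have [K1 fin1 HK1] := below e e0.
have [t [te res [K2 fin2 HK2]]] := HC0 e e0.
(* By symmetry the value of (T - mu - t)^-1 f at x is <h x, f>, small once f vanishes on a large
   finite set. *)
have [h hP] : {h : X -> X -> R & forall x, dom T (h x) /\
    shift T (mu + t) (h x) = dirac1 R x}.
  apply: (@choice _ _ (fun x k => dom T k /\ shift T (mu + t) k = dirac1 R x)) => x.
  by have [g dg gx] := resolvent_surj res (l2_dirac1 R x); exists g.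
have [d d0 Hd] := zero_extend_small mu fin1 (exprn_gt0 2 e0).
have [F FP] : {F : X -> set X & forall x, finite_set (F x) /\
    forall f, l2 f -> (forall y, F x y -> f y = 0) -> l2dot (h x) f ^+ 2 <= d * l2sq f}.
  apply: (@choice _ _ (fun x K => finite_set K /\ forall f, l2 f ->
    (forall y, K y -> f y = 0) -> l2dot (h x) f ^+ 2 <= d * l2sq f)) => x.
  by have [K finK HK] := l2_tail (dom_l2 Tsa (hP x).1) d0; exists K.
pose K3 := \bigcup_(x in K1) F x.
have fin3 : finite_set K3 by apply: bigcup_finite => // x _; have [] := FP x.
have finK : finite_set (K1 `|` K2 `|` K3) by rewrite !finite_setU.
(* All other choices precede f. Its vanishing on [K1] serves the form bound, on [K2] the bound of
   the resolvent g, and on [K3] the smallness of g on [K1]. *)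
have [f [df f0 Tf]] : exists f, [/\ dom T f,
    forall x, (K1 `|` K2 `|` K3) x -> f x = 0 & l2dot (T f) f < (mu + e) * l2sq f].
  apply: contrapT => nf; apply: (above e _ e0 finK) => f df f0.
  by rewrite leNgt; apply/negP => lt; apply: nf; exists f.
have lf := dom_l2 Tsa df; have lTf := app_l2 Tsa df.
have lAf := shift_l2 Tsa mu df.
have Af : l2dot (shift T mu f) f < e * l2sq f.
  rewrite shiftE (l2dotDl lTf (l2N (l2Z _ lf)) lf) l2dotNl (l2dotZl _ lf lf).
  by move: Tf; rewrite -/(l2sq f); lra.
have f_pos : 0 < l2sq f.
  rewrite lt_neqAle l2sq_ge0 andbT eq_sym; apply/eqP => n0.
  move: Af; rewrite n0 (l2sq_eq0 lf n0).
  by rewrite l2dotC l2dot0l mulr0 ltxx.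
have [g dg gf] := resolvent_surj res lf.
have lg := dom_l2 Tsa dg.
have ng : l2sq g <= C * l2sq f.
  apply: le_trans (HK2 f g lf _ dg gf) _.
    by move=> x K2x; apply: f0; left; right.
  by rewrite ler_wpM2r ?l2sq_ge0// /C; lra.
have gE x : g x = l2dot (h x) f.
  have [dh hx] := hP x.
  by rewrite -(l2dot_dirac1 x g) -hx (shift_sym Tsa _ dh dg) gf.
pose w := zero_extend K1 g.
have [nw nAw] : l2sq w <= e ^+ 2 * l2sq f /\ l2sq (shift T mu w) <= e ^+ 2 * l2sq f.
  apply: Hd => [|x K1x]; first exact: l2sq_ge0.
  rewrite gE; have [_ HF] := FP x; apply: HF => // y Fy.
  by apply: f0; right; exists x.
have dw : dom T w by exact: dom_zero_extend.
have lw := dom_l2 Tsa dw; have lAw := shift_l2 Tsa mu dw.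
pose g' := g - w.
have dg' : dom T g' by exact: domB.
have lg' := dom_l2 Tsa dg'; have lAg' := shift_l2 Tsa mu dg'.
have ltg := l2Z t lg.
have Ag' : shift T mu g' = f + t *: g - shift T mu w.
  by rewrite shiftB// -gf shift_shift subrK.
(* The form of A = T - mu at f - th g' is <A f, f> - 2 th <f, A g'> + th^2 <A g', g'>. As <A g', g'>
   <= 7 C |f|^2, this th makes the last term at most th / 2 |f|^2, while <f, A g'> >= 98/100 |f|^2
   makes the middle one a gain of 196/100 th |f|^2. *)
pose th := i / 14.
have th0 : 0 < th by rewrite /th; lra.
have dhh : dom T (f - th *: g') by apply: domB => //; exact: domZ.
have hh0 x : K1 x -> (f - th *: g') x = 0.
  move=> K1x; have fx : f x = 0 by apply: f0; left; left.
  have g'x : g' x = 0 by rewrite -[g' x]/(g x - zero_extend K1 g x) (zero_extend_in _ K1x) subrr.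
  by rewrite -[LHS]/(f x - th * g' x) fx g'x mulr0 subr0.
have lhh := dom_l2 Tsa dhh; have lThh := app_l2 Tsa dhh.
have lthg := l2Z th lg'.
have form : - e * l2sq (f - th *: g') <= l2dot (shift T mu (f - th *: g')) (f - th *: g').
  have := HK1 _ dhh hh0.
  rewrite shiftE (l2dotDl lThh (l2N (l2Z _ lhh)) lhh) l2dotNl (l2dotZl _ lhh lhh).
  by rewrite -/(l2sq _); lra.
have nhh : l2sq (f - th *: g') <= 2 * l2sq f + 2 * (th ^+ 2 * l2sq g').
  by have := l2sqD_le lf (l2N lthg); rewrite l2sqN (l2sqZ _ lg').
have formE : l2dot (shift T mu (f - th *: g')) (f - th *: g') =
    l2dot (shift T mu f) f - 2 * (th * l2dot f (shift T mu g'))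
    + th ^+ 2 * l2dot (shift T mu g') g'.
  rewrite shiftB//; last exact: domZ.
  rewrite shiftZ//.
  have lthAg := l2Z th lAg'.
  rewrite (l2dotDl lAf (l2N lthAg) lhh) l2dotNl.
  rewrite (l2dotDr lf (l2N lthg) lAf) (l2dotDr lf (l2N lthg) lthAg) !l2dotNr.
  rewrite (l2dotZl _ lAg' lf) (l2dotZr _ lAf lg') (l2dotZl _ lAg' lthg).
  rewrite (l2dotZr _ lAg' lg') (shift_sym Tsa _ df dg') (l2dotC (shift T mu g') f); ring.
have fAg' : l2dot f (shift T mu g') = l2sq f + t * l2dot f g - l2dot f (shift T mu w).
  rewrite Ag' (l2dotDr (l2D lf ltg) (l2N lAw) lf) l2dotNr.
  by rewrite (l2dotDr lf ltg lf) (l2dotZr _ lf lg).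
have C_pos : 0 <= C * l2sq f by rewrite mulr_ge0 ?l2sq_ge0//; lra.
have f_le : l2sq f <= C * l2sq f by rewrite ler_peMl// l2sq_ge0.
have fg : `|l2dot f g| <= C * l2sq f.
  rewrite ler_norml; apply/andP; split.
    have := l2dot_AMGM (-1) lf lg; rewrite sqrrN expr1n; lra.
  by have := l2dot_AMGM 1 lf lg; rewrite expr1n; lra.
have fAw : l2dot f (shift T mu w) <= e * l2sq f.
  have := l2dot_CS lf lAw.
  have := ler_wpM2l (l2sq_ge0 f) nAw; set b := l2dot f _ => b1 b2.
  rewrite leNgt; apply/negP => b3.
  have : (e * l2sq f) ^+ 2 < b ^+ 2.
    by rewrite ltrXn2r// ?nnegrE// ?mulr_ge0// ltW// mulr_gt0.
  lra.
have e2 : e ^+ 2 <= 1 by rewrite /e; nra.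
have t2 : t ^+ 2 <= 1.
  rewrite -real_normK ?num_real//; have := normr_ge0 t; rewrite /e in te *; nra.
have w1 : l2sq w <= l2sq f.
  by apply: le_trans nw _; rewrite ler_piMl// l2sq_ge0.
have Aw1 : l2sq (shift T mu w) <= l2sq f.
  by apply: le_trans nAw _; rewrite ler_piMl// l2sq_ge0.
have ng' : l2sq g' <= 4 * (C * l2sq f).
  by have := l2sqD_le lg (l2N lw); rewrite l2sqN -/g'; lra.
have nAg' : l2sq (shift T mu g') <= 10 * (C * l2sq f).
  rewrite Ag'; have := l2sqD_le (l2D lf ltg) (l2N lAw); rewrite l2sqN.
  have := l2sqD_le lf ltg; rewrite (l2sqZ _ lg).
  have : t ^+ 2 * l2sq g <= l2sq g by rewrite ler_piMl// l2sq_ge0.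
  lra.
have Ag'g' : l2dot (shift T mu g') g' <= 7 * (C * l2sq f).
  by have := l2dot_AMGM 1 lAg' lg'; rewrite expr1n; lra.
have tfg : - (e * (C * l2sq f)) <= t * l2dot f g.
  have : `|t * l2dot f g| <= e * (C * l2sq f).
    by rewrite normrM ler_pM// ltW.
  by rewrite ler_norml => /andP[].
have eC : e * (C * l2sq f) = l2sq f / 100.
  by rewrite /e -[RHS]mul1r -Ci; ring.
have thC : th ^+ 2 * (C * l2sq f) = th / 14 * l2sq f.
  by rewrite /th -[RHS]mul1r -Ci; ring.
have th2 := sqr_ge0 th.
have s1 := ler_wpM2l th2 Ag'g'.
have s2 := ler_wpM2l th2 ng'.
have s3 : th * (98 / 100 * l2sq f) <= th * l2dot f (shift T mu g').
  rewrite ler_wpM2l ?(ltW th0)// fAg'.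
  have : e * l2sq f <= l2sq f / 100.
    by have := ler_wpM2r (l2sq_ge0 f) i1; rewrite /e; lra.
  lra.
have s4 := ler_wpM2l (ltW e0) nhh.
have s5 : e * (th ^+ 2 * l2sq g') <= 4 / 14 * th * l2sq f.
  have le1 : e <= 1 by rewrite /e; lra.
  apply: le_trans (_ : 1 * (th ^+ 2 * l2sq g') <= _).
    by rewrite ler_wpM2r// mulr_ge0// l2sq_ge0.
  move: s2; rewrite mul1r; lra.
have eth : e * l2sq f = 14 / 100 * th * l2sq f by rewrite /e /th; field.
have thf : 0 < th * l2sq f by rewrite mulr_gt0.
move: form; rewrite formE; lra.
Qed.

Lemma form_gt_far lambda : (forall mu, mu <= lambda -> ~ essential_spectrum T mu) ->
  exists m K, [/\ lambda < m, finite_set K & form_ge_off K m].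
Proof.
move=> ness; apply: contrapT => nex.
pose M : set R := [set m | exists2 K, finite_set K & form_ge_off K m].
(* Positivity of T makes [M] nonempty, with no set removed. *)
have M0 : M 0 by exists set0 => // f df _; rewrite mul0r; exact: Tpos.
have ubM m : M m -> m <= lambda.
  move=> [K finK HK]; rewrite leNgt; apply/negP => lm; apply: nex.
  by exists m, K.
have supM : has_sup M by split; [exists 0|exists lambda => m /ubM].
have mul : sup M <= lambda by apply: ge_sup => [|m /ubM//]; exists 0.
apply: (ness _ mul); apply: sup_form_essential => [e e0|e K e0 finK HK].
  have [m [K finK HK] mm] := sup_adherent e0 supM.
  exists K => // f df f0; apply: le_trans (HK f df f0).
  by rewrite ler_wpM2r ?l2sq_ge0// ltW.
have : sup M + e <= sup M by apply: ub_le_sup; [case: supM|exists K].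
by rewrite gerDl leNgt e0.
Qed.

End FarFormBound.

(** * Geometric decay *)

Section GeometricDecay.
Context (R : realType).
Implicit Types (b : nat -> R) (d D r : R).

Lemma geometric_sum_le (s : R) m : 0 <= s -> s < 1 ->
  \sum_(i < m) s ^+ i <= (1 - s)^-1.
Proof.
move=> s0 s1; rewrite -[leRHS]mul1r ler_pdivlMr ?subr_gt0// mulrC.
rewrite -opprB mulNr -subrX1 opprB gerBl.
exact: exprn_ge0.
Qed.

(** If T n is the sum of b from n on, then b n + b (n + 1) = T n - T (n + 2) and T (n + 2) <= T (n +
    1), so (D + d) T (n + 2) <= D T n. Sums are cut at M, as convergence is not known beforehand. *)
Lemma tail_geometric_decay b d D n0 : 0 < d -> 0 <= D -> (forall k, 0 <= b k) ->
  (forall n M, (n0 <= n)%N ->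
    d * (\sum_(k < M | (n < k)%N) b k) <= D * (b n + b n.+1)) ->
  exists s C : R, [/\ 0 < s, s < 1, 0 <= C & forall j, b (n0 + j)%N <= C * s ^+ j].
Proof.
move=> d0 D0 b0 Hb.
pose T n M := \sum_(k < M | (n <= k)%N) b k.
have T0 n M : 0 <= T n M by apply: sumr_ge0.
have TS n M : (n < M)%N -> T n M = b n + T n.+1 M.
  move=> nM; rewrite /T (bigD1 (Ordinal nM))//=; congr (_ + _).
  apply: eq_bigl => k; rewrite [(n < k)%N]ltn_neqAle andbC eq_sym.
  by rewrite -val_eqE.
have T_out n M : (M <= n)%N -> T n M = 0.
  move=> Mn; rewrite /T big_pred0// => k.
  by apply/negbTE; rewrite -ltnNge (leq_trans (ltn_ord k)).
have T_step n M : (n0 <= n)%N -> (D + d) * T n.+2 M <= D * T n M.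
  move=> nn0; have [nM|Mn] := ltnP n.+1 M; last first.
    by rewrite T_out ?(leqW Mn)// mulr0 mulr_ge0.
  have := Hb n M nn0; rewrite -/(T n.+1 M).
  rewrite (TS n) ?(ltnW nM)// (TS n.+1)//.
  by have := ler_wpM2l (ltW d0) (b0 n.+1); have := T0 n.+2 M; lra.
pose q := D / (D + d).
have Dd : 0 < D + d by rewrite ltr_wpDl.
have q0 : 0 <= q by rewrite divr_ge0// ltW.
have q1 : q < 1 by rewrite ltr_pdivrMr// mul1r ltrDl.
have T_q n M : (n0 <= n)%N -> T n.+2 M <= q * T n M.
  by move=> nn0; rewrite /q mulrAC ler_pdivlMr// mulrC T_step.
(* Two radii gain the factor q, so one gains sqrt q. The mean of 1 and q exceeds it and is positive
   even for D = 0. *)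
pose s := (1 + q) / 2.
have s0 : 0 < s by rewrite /s; lra.
have s1 : s < 1 by rewrite /s; lra.
have qs : q <= s ^+ 2 by have := sqr_ge0 (1 - q); rewrite /s; lra.
pose K := D * (b n0 + b n0.+1) / d + b n0.
have K0 : 0 <= K by rewrite addr_ge0// divr_ge0 ?(ltW d0)// mulr_ge0// addr_ge0.
have TK M : T n0 M <= K.
  have [nM|Mn] := ltnP n0 M; last by rewrite T_out.
  by rewrite TS// /K addrC lerD2r ler_pdivlMr// mulrC Hb.
(* The two-step recursion has two initial values; the second, T (n0 + 1) <= K, requires K / s. *)
exists s, (K / s); split => //; first by rewrite divr_ge0// ltW.
suff H j M : T (n0 + j)%N M <= K / s * s ^+ j /\ T (n0 + j.+1)%N M <= K / s * s ^+ j.+1.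
  move=> j; have [+ _] := H j (n0 + j).+1.
  by rewrite TS// T_out// addr0.
elim: j => [|j [IH1 IH2]].
  rewrite addn0 expr0 mulr1 expr1 divfK ?gt_eqF//; split.
    by rewrite (le_trans (TK M))// ler_pdivlMr// ler_piMr// ltW.
  apply: le_trans (TK M); rewrite addn1.
  have [nM|Mn] := ltnP n0 M; last by rewrite T_out// leqW.
  by rewrite [leRHS]TS// lerDr.
split => //; rewrite !addnS.
apply: le_trans (T_q _ M (leq_addr _ _)) _.
apply: le_trans (ler_wpM2l q0 IH1) _.
rewrite mulrCA ler_wpM2l//; first by rewrite divr_ge0// ltW.
by rewrite !exprS mulrA -expr2 ler_wpM2r// exprn_ge0// ltW.
Qed.

Lemma expR_weight s : 0 < s -> s < 1 -> exists2 r : R, 0 < r &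
  expR r ^+ 2 * s < 1.
Proof.
(* This r turns the product into sqrt s. *)
move=> s0 s1; exists (- ln s / 4).
  by rewrite divr_gt0// oppr_gt0 ln_lt0// s0.
have ls : ln s < 0 by rewrite ln_lt0// s0.
rewrite -expRM_natl -{2}(lnK (x := s)) ?posrE// -expRD expR_lt1.
by lra.
Qed.

Lemma tail_exponential_sum b d D n0 : 0 < d -> 0 <= D -> (forall k, 0 <= b k) ->
  (forall n M, (n0 <= n)%N ->
    d * (\sum_(k < M | (n < k)%N) b k) <= D * (b n + b n.+1)) ->
  exists2 r : R, 0 < r & exists C, forall M,
    \sum_(k < M) b k * expR (r * k%:R) ^+ 2 <= C.
Proof.
move=> d0 D0 b0 Hb.
have [s [C [s0 s1 C0 HC]]] := tail_geometric_decay d0 D0 b0 Hb.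
have [r r0 rs] := expR_weight s0 s1.
pose E := expR r ^+ 2.
have E0 : 0 < E by rewrite exprn_gt0// expR_gt0.
have expE k : expR (r * k%:R) ^+ 2 = E ^+ k.
  by rewrite mulrC expRM_natl -!exprM mulnC.
have Es : E * s < 1 by [].
clearbody E.
exists r => //; exists (\sum_(k < n0) b k * E ^+ k + C * E ^+ n0 * (1 - E * s)^-1) => M.
under eq_bigr do rewrite expE.
apply: le_trans (_ : \sum_(k < n0 + M) b k * E ^+ k <= _).
  rewrite addnC big_split_ord/= lerDl sumr_ge0// => k _.
  by rewrite mulr_ge0// exprn_ge0// ltW.
rewrite big_split_ord/= lerD2l.
apply: le_trans (_ : \sum_(j < M) C * E ^+ n0 * (E * s) ^+ j <= _).
  apply: ler_sum => j _; rewrite exprD exprMn.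
  apply: le_trans (ler_wpM2r _ (HC j)) _.
    by rewrite mulr_ge0// exprn_ge0// ltW.
  by rewrite !mulrA [C * s ^+ j * _]mulrAC [C * _ * s ^+ j * _]mulrAC.
rewrite -mulr_sumr ler_wpM2l//; first by rewrite mulr_ge0// exprn_ge0// ltW.
by apply: geometric_sum_le => //; rewrite mulr_ge0// ltW.
Qed.

End GeometricDecay.

(** * Distance and cut-offs on the graph *)

Section GraphDistance.
Context (X : choiceType) (adj : rel X) (D : nat) (o : X).
Context (conn : connected_graph adj) (bdeg : bounded_degree adj D).

(** Connectedness provides a walk and well-ordering a shortest one, so the default of [xget] never
    occurs. *)
Lemma gdistP x : walk adj o x (gdist adj o x) /\
  forall n, walk adj o x n -> (gdist adj o x <= n)%N.
Proof.
rewrite /gdist; case: xgetP => [n _ []//|noP].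
have ex_n : exists n, `[< walk adj o x n >].
  by have [n w] := conn o x; exists n; apply/asboolP.
case: (ex_minnP ex_n) => n /asboolP w nmin.
exfalso; apply: (noP n); split => // m wm.
by apply: nmin; apply/asboolP.
Qed.

Lemma gdist_adj x y : adj x y -> (gdist adj o y <= (gdist adj o x).+1)%N.
Proof.
move=> xy; have [[p [pp pl ps]] _] := gdistP x.
have [_] := gdistP y; apply; exists (rcons p y).
by rewrite rcons_path last_rcons size_rcons pp pl ps.
Qed.

Lemma finite_nbrs x : finite_set (nbrs adj x).
Proof. exact: (card_le_finite (bdeg x)). Qed.

Definition dist_ball (n : nat) : set X := [set x | (gdist adj o x <= n)%N].
Definition dist_sphere (n : nat) : set X := [set x | gdist adj o x = n].

Lemma ballS n : dist_ball n.+1 = dist_ball n `|` dist_sphere n.+1.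
Proof.
apply/seteqP; split=> x /=; rewrite /dist_ball /dist_sphere /=.
  by rewrite leq_eqVlt ltnS => /orP[/eqP|]; [right|left].
by move=> [/leqW|->].
Qed.

Lemma ball0 : dist_ball 0 = dist_sphere 0.
Proof. by apply/seteqP; split=> x /=; rewrite /dist_ball /dist_sphere /= leqn0 => /eqP. Qed.

(** Dropping the last vertex of a shortest walk places the sphere of radius n + 1 among the
    neighbours of the ball of radius n. *)
Lemma finite_ball n : finite_set (dist_ball n).
Proof.
elim: n => [|n IH].
  apply: (@sub_finite_set _ _ [set o]) => // x; rewrite ball0 /dist_sphere /= => x0.
  have [[p [_ pl ps]] _] := gdistP x; rewrite x0 in ps.
  by rewrite (size0nil ps) in pl.
rewrite ballS finite_setU; split => //.
apply: (@sub_finite_set _ _ (\bigcup_(x in dist_ball n) nbrs adj x)).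
  move=> y; rewrite /dist_sphere /= => yn.
  have [[p [pp pl ps]] _] := gdistP y; rewrite yn in ps.
  case/lastP: p pp pl ps => // p z; rewrite rcons_path last_rcons size_rcons.
  move=> /andP[pp pz] zy [ps]; exists (last o p); last by rewrite /nbrs /= -zy.
  by have [_] := gdistP (last o p); apply; exists p.
by apply: bigcup_finite => // x _; exact: finite_nbrs.
Qed.

Lemma finite_sphere n : finite_set (dist_sphere n).
Proof.
apply: sub_finite_set (finite_ball n) => x; rewrite /dist_sphere /dist_ball /=.
by move=> ->.
Qed.

Lemma fsum_ball (R : realType) (G : X -> R) n :
  \sum_(x \in dist_ball n) G x = \sum_(k < n.+1) \sum_(x \in dist_sphere k) G x.
Proof.
elim: n => [|n IH]; first by rewrite big_ord1 ball0.
rewrite big_ord_recr /= -IH ballS fsbigU0//.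
- exact: finite_ball.
- exact: finite_sphere.
by move=> x; rewrite /dist_ball /dist_sphere /= => -[+ xn]; rewrite xn ltnn.
Qed.

Lemma fsum_nbrs_le (R : realType) x (W : set X) : finite_set W ->
  \sum_(y \in W) ((adj x y)%:R : R) <= D%:R.
Proof.
move=> finW; have finN := finite_nbrs x.
apply: (@le_trans _ _ (\sum_(y \in W `|` nbrs adj x) ((adj x y)%:R : R))).
  by apply: fsum_subset; rewrite ?finite_setU.
rewrite -(fsbig_widen (nbrs adj x))//; last first.
  by move=> y [_ /negP/negPf /= ->].
rewrite fsbig_finite//; apply: (@le_trans _ _ (\sum_(y <- fset_set (nbrs adj x)) (1 : R))).
  by apply: ler_sum => y _; rewrite lern1; case: adj.
rewrite big_const_seq count_predT iter_addr_0 ler_nat.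
exact: geq_card_fset_set (bdeg x).
Qed.

End GraphDistance.

(** * The Schroedinger operator and its form on cut-offs *)

Section SchroedingerOperator.
Context (R : realType) (X : choiceType) (adj : rel X) (D : nat) (q : X -> R).
Implicit Types (f g u : X -> R) (S W Z : set X).
Context (adj_sym : symmetric adj) (bdeg : bounded_degree adj D).
Local Notation H := (schroedinger_op adj q).

Lemma laplacianE f x : laplacian adj f x =
  \sum_(y <- fset_set (nbrs adj x)) (f x - f y).
Proof. by rewrite /laplacian fsbig_finite//; exact: finite_nbrs bdeg x. Qed.

Lemma schroedinger_linear : linear_operator H.
Proof.
move=> a f g [lf lqf] [lg lqg]; split.
  split; first exact: l2_lin.
  rewrite (_ : (fun x => _) = a *: (fun x => q x * f x) + (fun x => q x * g x)).
    exact: l2_lin.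
  by apply/funext => x; rewrite !fctE /GRing.scale /= mulrDr mulrCA.
apply/funext => x.
rewrite -[RHS]/(a * schroedinger adj q f x + schroedinger adj q g x).
rewrite -[LHS]/(schroedinger adj q (a *: f + g) x) /schroedinger !laplacianE.
rewrite [a * (_ + _)]mulrDr [RHS]addrACA mulr_sumr -big_split/=; congr (_ + _).
  by apply: eq_bigr => y _; rewrite !fctE /GRing.scale /=; ring.
by rewrite !fctE /GRing.scale /=; ring.
Qed.

Lemma dom_schroedinger_dirac x : dom H (dirac1 R x).
Proof.
split; first exact: l2_dirac1.
apply: (fin_l2 (finite_set1 x)) => y /= yx.
by rewrite dirac1E; case: eqP yx => [->|_]; rewrite ?mulr0.
Qed.

(* Since [(H - lambda) u = 0], only the edges leaving [S] contribute. *)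
Lemma cutoff_form_le lambda u S W Z : finite_set S -> finite_set W ->
  (forall x, schroedinger adj q u x = lambda * u x) ->
  S `<=` W -> (forall x y, S x -> adj x y -> W y) ->
  (forall x y, S x -> ~ S y -> adj x y -> Z x /\ Z y) ->
  l2dot (shift H lambda (zero_extend S u)) (zero_extend S u) <=
  D%:R * (\sum_(x \in W) zero_extend Z u x ^+ 2).
Proof.
move=> finS finW Hu SW nW bdZ.
pose v x := zero_extend Z u x ^+ 2.
have v0 x : 0 <= v x by exact: sqr_ge0.
rewrite l2dotC (l2dot_fin _ finS); last by move=> x; exact: zero_extend_out.
have inner x : S x -> zero_extend S u x * shift H lambda (zero_extend S u) x <=
    \sum_(y \in W) (adj x y)%:R * ((v x + v y) / 2).
  move=> Sx; rewrite zero_extend_in//.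
  (* The equation replaces [lambda * u x] by the operator applied to u; the potential cancels, and
     what remains only sees neighbours where u and its cut-off differ. *)
  have -> : shift H lambda (zero_extend S u) x =
      \sum_(y \in nbrs adj x) (u y - zero_extend S u y).
    rewrite /shift /= /schroedinger zero_extend_in//.
    have := Hu x; rewrite /schroedinger => <-.
    rewrite opprD addrACA subrr addr0 !laplacianE zero_extend_in//.
    rewrite fsbig_finite; last exact: finite_nbrs bdeg x.
    by rewrite -sumrB; apply: eq_bigr => y _; ring.
  rewrite mulr_fsumr.
  rewrite -(fsbig_widen (nbrs adj x) W); last 2 first.
  - by move=> y xy; apply: nW xy.
  - by move=> y [_ /negP/negPf /= ->]; rewrite mul0r.
  rewrite !(fsbig_finite _ _ (finite_nbrs bdeg x)).
  rewrite big_seq [leRHS]big_seq; apply: ler_sum => y.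
  rewrite in_fset_set; last exact: finite_nbrs bdeg x.
  move=> /set_mem xy; rewrite -[nbrs adj x y]/(is_true (adj x y)) in xy; rewrite xy mul1r.
  have [Sy|Sy] := pselect (S y).
    by rewrite zero_extend_in// subrr mulr0 divr_ge0// addr_ge0.
  rewrite zero_extend_out// subr0 /v.
  have [Zx Zy] := bdZ x y Sx Sy xy; rewrite !zero_extend_in//.
  by have := sqr_ge0 (u x - u y); lra.
apply: (@le_trans _ _ (\sum_(x \in S) \sum_(y \in W) (adj x y)%:R * ((v x + v y) / 2))).
  rewrite !(fsbig_finite _ _ finS) big_seq [leRHS]big_seq; apply: ler_sum => x.
  by rewrite in_fset_set// => /set_mem; exact: inner.
(* Enlarging the outer sum to [W] adds nonnegative terms and makes the double sum symmetric. *)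
apply: (@le_trans _ _ (\sum_(x \in W) \sum_(y \in W) (adj x y)%:R * ((v x + v y) / 2))).
  apply: fsum_subset => // x; apply: fsumr_ge0 => y _.
  by rewrite mulr_ge0// divr_ge0// addr_ge0.
rewrite !(fsbig_finite _ _ finW).
under eq_bigr do rewrite (fsbig_finite _ _ finW).
(* Symmetry of adjacency moves both halves to x, where the degree bound counts the y. *)
pose F x y := (adj x y)%:R * (v x / 2).
have -> : \sum_(x <- fset_set W) \sum_(y <- fset_set W) (adj x y)%:R * ((v x + v y) / 2) =
    \sum_(x <- fset_set W) \sum_(y <- fset_set W) F x y +
    \sum_(x <- fset_set W) \sum_(y <- fset_set W) F x y.
  rewrite [X in _ = _ + X]exchange_big/= -big_split/=; apply: eq_bigr => x _.
  rewrite -big_split/=; apply: eq_bigr => y _; rewrite /F [adj y x]adj_sym; ring.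
have F_le : \sum_(x <- fset_set W) \sum_(y <- fset_set W) F x y <=
    \sum_(x <- fset_set W) D%:R * (v x / 2).
  apply: ler_sum => x _; rewrite -mulr_suml ler_wpM2r//.
    by rewrite divr_ge0.
  by have := fsum_nbrs_le bdeg R x finW; rewrite fsbig_finite.
apply: le_trans (lerD F_le F_le) _.
rewrite -big_split mulr_sumr/=; apply: ler_sum => x _.
by rewrite -/(v x); lra.
Qed.

End SchroedingerOperator.

(** * Masses on spheres *)

Section Decay.
Context (R : realType) (X : choiceType) (adj : rel X) (D : nat) (o : X).
Context (conn : connected_graph adj) (bdeg : bounded_degree adj D)
  (adj_sym : symmetric adj).
Implicit Types (q u f : X -> R) (K : set X).

Definition sphere_mass u k : R := \sum_(x \in dist_sphere adj o k) u x ^+ 2.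

Lemma sphere_mass_ge0 u k : 0 <= sphere_mass u k.
Proof. by apply: fsumr_ge0 => x _; exact: sqr_ge0. Qed.

Lemma fsum_ball_zero_extend u (P : pred nat) n :
  \sum_(x \in dist_ball adj o n) zero_extend [set x | P (gdist adj o x)] u x ^+ 2 =
  \sum_(k < n.+1 | P k) sphere_mass u k.
Proof.
rewrite (fsum_ball _ conn bdeg) [RHS]big_mkcond/=; apply: eq_bigr => k _.
case: ifPn => Pk; [apply: eq_fsbigr|apply: fsbig1] => x.
  by move=> /set_mem xk; rewrite zero_extend_in//= xk.
move=> xk; rewrite zero_extend_out ?expr0n//= xk; exact/negP.
Qed.

(** The annulus is the union of the spheres N and N + 1, also for N = 0, where the inner ball is
    empty. It is finite, so the norm is meaningful for every u. *)
Lemma annulus_sphere_mass u N :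
  sphere_mass u N + sphere_mass u N.+1 <=
  l2norm (zero_extend (gball adj o (N%:Z + 1) `\` gball adj o (N%:Z - 1)) u) ^+ 2.
Proof.
rewrite l2normE sqr_sqrtr ?l2sq_ge0//.
pose P k := (N <= k <= N.+1)%N.
have -> : gball adj o (N%:Z + 1) `\` gball adj o (N%:Z - 1) =
    [set x | P (gdist adj o x)].
  apply/seteqP; split=> x; rewrite /gball /P /=; first by case=> + /negP; lia.
  by move=> xN; split; [|apply/negP]; lia.
have finB := finite_ball o conn bdeg N.+1.
have lz : l2 (zero_extend [set x | P (gdist adj o x)] u).
  apply: (fin_l2 finB) => x; rewrite /dist_ball /= => xN; apply: zero_extend_out.
  by rewrite /P /=; lia.
apply: le_trans (fsum_le_l2sq lz finB); rewrite fsum_ball_zero_extend big_mkcond.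
rewrite !big_ord_recr/= /P !leqnn !leqnSn -addrA lerDr sumr_ge0// => k _.
by case: ifP => // _; exact: sphere_mass_ge0.
Qed.

Lemma l2_of_sphere_mass u (w : nat -> R) C :
  (forall n, \sum_(k < n) sphere_mass u k * w k ^+ 2 <= C) ->
  l2 (fun x => u x * w (gdist adj o x)).
Proof.
move=> HC; apply: (@psummable_le _ _ _ C) => A finA.
have [n An] : exists n, A `<=` dist_ball adj o n.
  exists (\max_(x <- fset_set A) gdist adj o x)%N => x Ax.
  by rewrite /dist_ball /=; apply: leq_bigmax_seq => //; rewrite in_fset_set// mem_set.
apply: le_trans (HC n.+1).
apply: le_trans (fsum_subset (finite_ball o conn bdeg n) An _) _.
  by move=> x; exact: sqr_ge0.
rewrite (fsum_ball _ conn bdeg); apply: ler_sum => k _; rewrite /sphere_mass mulr_fsuml.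
by rewrite le_eqVlt; apply/orP; left; apply/eqP/eq_fsbigr => x /set_mem xk; rewrite exprMn xk.
Qed.

(** Beyond the largest distance [n0] in [K] the cut-off of u vanishes on [K]. Its finite support
    puts it in the domain although u may fail to be there. *)
Lemma sphere_mass_tail q lambda u m K :
  linear_operator (schroedinger_op adj q) ->
  self_adjoint (schroedinger_op adj q) ->
  lambda < m -> finite_set K -> form_ge_off (schroedinger_op adj q) K m ->
  (forall x, schroedinger adj q u x = lambda * u x) ->
  exists n0, forall n N, (n0 <= n)%N ->
    (m - lambda) * (\sum_(k < N.+1 | (n < k)%N) sphere_mass u k) <=
    D%:R * (sphere_mass u n + sphere_mass u n.+1 +
            (sphere_mass u N + sphere_mass u N.+1)).
Proof.
move=> Hlin Hsa lm finK HK Hu.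
exists (\max_(x <- fset_set K) gdist adj o x)%N => n N Kn.
have K_ball x : K x -> (gdist adj o x <= n)%N.
  move=> Kx; apply: leq_trans Kn.
  by apply: leq_bigmax_seq => //; rewrite in_fset_set// mem_set.
pose PS k := ((n < k) && (k <= N))%N.
(* Distances of adjacent vertices differ by at most one, so an edge leaving [S] joins the spheres n
   and n + 1, or N and N + 1. *)
pose PZ k := k \in [:: n; n.+1; N; N.+1].
pose S := [set x | PS (gdist adj o x)].
pose Z := [set x | PZ (gdist adj o x)].
have finN := finite_ball o conn bdeg N.
have finW := finite_ball o conn bdeg N.+1.
have SN : S `<=` dist_ball adj o N by move=> x /andP[].
have finS : finite_set S by exact: sub_finite_set SN finN.
have df : dom (schroedinger_op adj q) (zero_extend S u).
  by apply: dom_zero_extend => //; exact: dom_schroedinger_dirac.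
have lf := dom_l2 Hsa df; have lHf := app_l2 Hsa df.
have fS x : ~ S x -> zero_extend S u x = 0 by exact: zero_extend_out.
have := HK _ df.
have f0 x : K x -> zero_extend S u x = 0.
  by move=> /K_ball xn; apply: fS; rewrite /S /PS /=; lia.
move=> /(_ f0) form.
have cut : l2dot (shift (schroedinger_op adj q) lambda (zero_extend S u))
    (zero_extend S u) <= D%:R * (\sum_(x \in dist_ball adj o N.+1) zero_extend Z u x ^+ 2).
  apply: cutoff_form_le => //.
  - by move=> x /SN; rewrite /dist_ball /=; lia.
  - move=> x y /SN; rewrite /dist_ball /= => xN /(gdist_adj o conn); lia.
  move=> x y; rewrite /S /Z /PS /PZ /= => Sx Sy xy.
  have xy' := gdist_adj o conn xy.
  have yx' : (gdist adj o x <= (gdist adj o y).+1)%N.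
    by apply: (gdist_adj _ conn); rewrite adj_sym.
  by rewrite !inE; lia.
have mass_S : l2sq (zero_extend S u) = \sum_(k < N.+1 | (n < k)%N) sphere_mass u k.
  rewrite l2sqE (psum_fin _ finN); last 2 first.
  - by move=> x; exact: sqr_ge0.
  - by move=> x xN; rewrite fS ?expr0n// => /SN.
  rewrite fsum_ball_zero_extend; apply: eq_bigl => k.
  by rewrite /PS; have := ltn_ord k; lia.
have mass_Z : \sum_(x \in dist_ball adj o N.+1) zero_extend Z u x ^+ 2 <=
    sphere_mass u n + sphere_mass u n.+1 + (sphere_mass u N + sphere_mass u N.+1).
  rewrite fsum_ball_zero_extend.
  (* The four radii may coincide and the inner ones may exceed N + 1, so each is bounded
     separately. *)
  have pick j : \sum_(k < N.+2) (if k == j :> nat then sphere_mass u k else 0) <=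
      sphere_mass u j.
    have [jN|Nj] := ltnP j N.+2.
      by rewrite -big_mkcond (big_pred1 (Ordinal jN)).
    rewrite big1 ?sphere_mass_ge0// => k _; case: eqP => // kj.
    by have := ltn_ord k; lia.
  apply: le_trans (lerD (lerD (pick n) (pick n.+1)) (lerD (pick N) (pick N.+1))).
  rewrite big_mkcond -!big_split/=; apply: ler_sum => k _.
  have b0 := sphere_mass_ge0 u k.
  rewrite /PZ !inE.
  do 4 (case: eqP => _ /=); lra.
rewrite -mass_S; apply: le_trans (ler_wpM2l _ mass_Z) => //.
apply: le_trans cut; move: form.
rewrite shiftE (l2dotDl lHf (l2N (l2Z _ lf)) lf) l2dotNl (l2dotZl _ lf lf).
by rewrite -/(l2sq (zero_extend S u)) /=; lra.
Qed.

End Decay.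

Unset Implicit Arguments.

Theorem theorem1 (R : realType) (X : choiceType) (adj : rel X) (D : nat)
  (o : X) (q : X -> R) (lambda : R) (u : X -> R) :
  infinite_set [set: X] ->
  countable [set: X] ->
  symmetric adj ->
  irreflexive adj ->
  connected_graph adj ->
  bounded_degree adj D ->
  self_adjoint (schroedinger_op adj q) ->
  positive_operator (schroedinger_op adj q) ->
  (lambda%:E < ereal_inf
     [set z%:E | z in essential_spectrum (schroedinger_op adj q)])%E ->
  (forall x, schroedinger adj q u x = lambda * u x) ->
  (fun n : nat => l2norm (zero_extend
     (gball adj o (n%:Z + 1) `\` gball adj o (n%:Z - 1)) u)) @ \oo --> (0 : R) ->
  exists2 r : R, 0 < r &
    l2 (fun x => u x * expR (r * (gdist adj o x)%:R)).
Proof.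
move=> _ _ adj_sym _ conn bdeg Hsa Hpos ess_gt Hu u0.
have Hlin : linear_operator (schroedinger_op adj q) by exact: schroedinger_linear bdeg.
have ness mu : mu <= lambda -> ~ essential_spectrum (schroedinger_op adj q) mu.
  move=> mul ess; move: ess_gt; rewrite ltNge => /negP; apply.
  apply: (@le_trans _ _ mu%:E); last by rewrite lee_fin.
  by apply: ereal_inf_lbound; exists mu.
have [m [K [lm finK HK]]] :=
  form_gt_far Hlin Hsa Hpos (dom_schroedinger_dirac adj q) ness.
have [n0 tail] := sphere_mass_tail o conn bdeg adj_sym Hlin Hsa lm finK HK Hu.
have ml : 0 < m - lambda by rewrite subr_gt0.
have Hb n M : (n0 <= n)%N ->
    (m - lambda) * (\sum_(k < M | (n < k)%N) sphere_mass adj o u k) <=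
    D%:R * (sphere_mass adj o u n + sphere_mass adj o u n.+1).
  move=> n0n; apply/ler_addgt0Pl => e e0.
  have D0 : 0 <= D%:R :> R by exact: ler0n.
  (* Beyond M there is a radius N with boundary mass at most e', which costs at most e. The summand
     1 covers D = 0. *)
  pose e' := e / (D%:R + 1).
  have e'0 : 0 < e' by rewrite divr_gt0//; lra.
  have [N MN Ne] : exists2 N, (M <= N)%N &
      sphere_mass adj o u N + sphere_mass adj o u N.+1 <= e'.
    (* The hypothesis concerns the norm, the masses its square. *)
    have s0 : 0 < Num.sqrt e' by rewrite sqrtr_gt0.
    move/cvgrPdist_lt : u0 => /(_ _ s0)[N0 _ HN0].
    exists (maxn M N0); first exact: leq_maxl.
    apply: le_trans (annulus_sphere_mass o conn bdeg u _) _.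
    have := HN0 (maxn M N0) (leq_maxr _ _); rewrite /= sub0r normrN.
    rewrite ger0_norm ?sqrtr_ge0// => /ltW lt.
    by rewrite -[leRHS](sqr_sqrtr (ltW e'0)) lerXn2r// nnegrE sqrtr_ge0.
  have := tail n N n0n; rewrite mulrDr.
  have : D%:R * (sphere_mass adj o u N + sphere_mass adj o u N.+1) <= e.
    apply: le_trans (ler_wpM2l D0 Ne) _.
    by rewrite /e' mulrCA ler_piMr ?(ltW e0)// ler_pdivrMr; lra.
  have : (m - lambda) * (\sum_(k < M | (n < k)%N) sphere_mass adj o u k) <=
      (m - lambda) * (\sum_(k < N.+1 | (n < k)%N) sphere_mass adj o u k).
    rewrite ler_pM2l// -(subnKC (leqW MN)) big_split_ord/= lerDl.
    by apply: sumr_ge0 => k _; exact: sphere_mass_ge0.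
  lra.
have [r r0 [C HC]] := tail_exponential_sum ml (ler0n R D)
  (sphere_mass_ge0 adj o u) Hb.
by exists r => //; exact: (l2_of_sphere_mass conn bdeg (w := fun k => expR (r * k%:R)) HC).
Qed.
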